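(* Let $n\in\mathbb{N}$, $r>0$, $T>0$, and let $D\subset\mathbb{R}^n$ be a convex domain of class $\mathcal{C}^{1,1}_r$. There is a constant $C=C(T,n,r)>0$ such that for all $x,y\in D$, all $0<t<T$, and any half-spaces $H_x,H_y$ with $D\subset H_x\cap H_y$, $\delta_{H_x}(x)=\delta_D(x)$ and $\delta_{H_y}(y)=\delta_D(y)$, $$p_D(t,x,y)\leq C\, p(t,x,y)\left[\left(1\wedge \frac{\delta_D(x)\delta_D(y)}{t}\right)+\left(1\wedge \frac{\delta_{H_x}(x)\delta_{H_x}(y)}{t}\right)\left(1\wedge \frac{\delta_{H_y}(y)\delta_{H_y}(x)}{t}\right)\right].$$
   Context: A domain is an open connected subset of $\mathbb{R}^n$ (here with nonempty boundary). $a\wedge b=\min\{a,b\}$. $p(t,x,y)=(4\pi t)^{-n/2}e^{-|x-y|^2/(4t)}$ is the global heat kernel of the Laplacian $\Delta$ on $\mathbb{R}^n$. $p_D(t,x,y)$ is the Dirichlet heat kernel of $D$: the fundamental solution of the heat equation $\partial_t u=\Delta u$ in $D$ with Dirichlet condition on $\partial D$; equivalently, the transition density of Brownian motion (normalized to have transition density $p(t,x,y)$) killed upon leaving $D$. For an open set $E$ and a point $x\in E$, $\delta_E(x)$ is the distance from $x$ to $\partial E$. Half-spaces are open. A $\mathcal{C}^{1,1}$ set is one whose boundary is locally the graph of a $\mathcal{C}^{1,1}$ function; $\mathcal{C}^{1,1}_r(\mathbb{R}^n)$ denotes the class of $\mathcal{C}^{1,1}$ sets such that for every boundary point $z\in\partial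 D$ there are two balls of radius at least $r$ tangent to $D$ at $z$, one contained in $D$ and the other in $D^c$. *)

(* Defs.v *)
From mathcomp Require Import all_boot all_order all_algebra.
From mathcomp Require Import all_classical all_reals all_analysis.
Import Order.TTheory GRing.Theory Num.Theory.
Import numFieldNormedType.Exports.

Set Implicit Arguments.
Unset Strict Implicit.
Unset Printing Implicit Defensive.

Local Open Scope classical_set_scope.
Local Open Scope ring_scope.

Section Euclidean.
Context {R : realType} {n : nat}.
Implicit Types (x y z v nu : 'rV[R]_n) (D E H : set 'rV[R]_n).

Definition dotv x y : R := \sum_(i < n) x 0 i * y 0 i.

(* The library norm on ['rV[R]_n] is the sup norm; it induces the same
   topology as this one. *)
Definition enorm x : R := Num.sqrt (dotv x x).

Definition eball z (rho : R) : set 'rV[R]_n := [set x | enorm (x - z) < rho].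

Definition boundary E : set 'rV[R]_n := closure E `\` interior E.

Definition dist_boundary E x : R := inf [set enorm (x - z) | z in boundary E].

Definition domain D : Prop :=
  [/\ open D, connected D & boundary D !=set0].

Definition halfspace H : Prop :=
  exists nu (c : R), nu != 0 /\ H = [set x | c < dotv nu x].

Definition C11_fun (f : 'rV[R]_n -> R) : Prop :=
  (forall x, differentiable f x) /\
  exists L : R, forall x y v,
    `|'D_v f x - 'D_v f y| <= L * enorm (x - y) * enorm v.

(* Near [z], [D] is the region above a C^{1,1} graph in the direction of the
   unit vector [nu].  A function of the n - 1 coordinates orthogonal to [nu] is
   encoded as a function on R^n that is constant along [nu]. *)
Definition C11_at D z : Prop :=
  exists nu (psi : 'rV[R]_n -> R) (rho : R),
    [/\ enorm nu = 1, 0 < rho, C11_fun psi,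
        forall x (s : R), psi (x + s *: nu) = psi x &
        D `&` eball z rho = [set x | psi x < dotv nu x] `&` eball z rho].

Definition two_balls_at (r : R) D z : Prop :=
  exists (a b : 'rV[R]_n) (ra rb : R),
    [/\ r <= ra /\ r <= rb, eball a ra `<=` D, eball b rb `<=` ~` D,
        enorm (z - a) = ra & enorm (z - b) = rb].

Definition C11_class (r : R) D : Prop :=
  forall z, boundary D z -> C11_at D z /\ two_balls_at r D z.

Definition heat_kernel (t : R) x y : R :=
  (4 * pi * t) `^ (- (n%:R / 2)) * expR (- (enorm (x - y) ^+ 2 / (4 * t))).

End Euclidean.

Section DirichletHeatKernel.
Context {R : realType}.
Local Open Scope ereal_scope.

(* Iterated integral; by Tonelli it is the integral with respect to the
   n-dimensional Lebesgue measure when [f] is nonnegative and Borel. *)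
Fixpoint lebesgue_int (n : nat) : ('rV[R]_n -> \bar R) -> \bar R :=
  match n with
  | 0%N => fun f => f 0%R
  | m.+1 => fun f =>
      \int[lebesgue_measure]_(s in setT)
        lebesgue_int (fun v : 'rV[R]_m => f (row_mx (const_mx s : 'rV[R]_1) v))
  end.

Context {n : nat}.
Implicit Types D : set 'rV[R]_n.

(* Brownian motion started at 0 with transition density [heat_kernel]: each
   coordinate of [W t - W s] has variance [2 * (t - s)].  Only the times
   [0 <= t] matter. *)
Definition brownian_motion d (Omega : measurableType d)
    (P : probability Omega R) (W : R -> Omega -> 'rV[R]_n) : Prop :=
  [/\ forall t i, (0 <= t)%R -> measurable_fun setT (fun w => W t w ord0 i),
      forall w, W 0%R w = 0%R,
      forall w, {within `[0%R, +oo[, continuous (W ^~ w)} &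
      forall (k : nat) (s : nat -> R) (A : nat -> 'I_n -> set R),
        (0 <= s 0%N)%R -> (forall j, (j < k)%N -> (s j < s j.+1)%R) ->
        (forall j i, measurable (A j i)) ->
        P [set w | forall (j : 'I_k) (i : 'I_n),
                     A j i (W (s j.+1) w ord0 i - W (s j) w ord0 i)%R] =
        \prod_(j < k) \prod_(i < n)
          normal_prob 0 (Num.sqrt (2 * (s j.+1 - s j))) (A j i)].

Definition exit_time (Omega : Type) (X : R -> Omega -> 'rV[R]_n) D
    (w : Omega) : \bar R :=
  ereal_inf [set s%:E | s in [set s | (0 <= s)%R /\ ~ D (X s w)]].

(* The transition density of Brownian motion killed upon leaving [D], in its
   version that is continuous in the second space variable; this determines
   [pD t x y] for [0 < t] and [x], [y] in [D].  All Brownian motions have the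
   same law, so the choice of [W] is immaterial. *)
Definition dirichlet_heat_kernel D
    (pD : R -> 'rV[R]_n -> 'rV[R]_n -> R) : Prop :=
  (forall t x y, (0 < t)%R -> D x -> D y ->
     (0 <= pD t x y)%R /\ {for y, continuous (pD t x)}) /\
  exists d (Omega : measurableType d) (P : probability Omega R)
         (W : R -> Omega -> 'rV[R]_n),
    brownian_motion P W /\
    forall t x (A : set 'rV[R]_n), (0 < t)%R -> D x ->
      <<s [set U : set 'rV[R]_n | open U] >> A -> A `<=` D ->
      let X s w := (x + W s w)%R in
      P [set w | A (X t w) /\ t%:E < exit_time X D w] =
      lebesgue_int (fun y => (pD t x y * \1_A y)%:E).

End DirichletHeatKernel.

(* Main.v *)
From HB Require Import structures.
Require Import Defs.
From mathcomp Require Import all_boot all_order all_algebra.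
From mathcomp Require Import all_classical all_reals all_analysis.
From mathcomp Require Import measurable_realfun ring lra.
Import Order.TTheory GRing.Theory Num.Theory.
Import numFieldNormedType.Exports.

(* Write [d_x], [d_y] for the distances to the boundaries of [Hx], [Hy], extended linearly.
   The killed path stays in [Hx] and in [Hy]; it is required to stay in [Hx] up to a time
   [t1] and in [Hy] from then on.  With a half-space kernel on each side this bounds
   [p_D(t, x, y)] by [p(t, x, y)] times the expectation, under the Brownian bridge from [x]
   to [y] at time [t1], of [(d_x(x) d_x(z) / t1) (d_y(y) d_y(z) / (t - t1))].  The point is
   the choice of [t1]: with [k = max(d_x(y), sqrt t) / max(d_y(x), sqrt t)] and
   [(t - t1) / t1 = k ^ 2] this product is the one in the theorem.  When
   [d_x(x) d_x(y) >= t] or [d_y(y) d_y(x) >= t] one half-space suffices.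

   The half-space bound needs no reflection principle.  On a fine time grid, the kernel [q]
   of the half-space enlarged by [eps] is almost a supersolution: one Gaussian step
   restricted to the original half-space increases [q] by a factor at most
   [1 + O(expR (- eps ^ 2 / (8 h)))], [h] being the mesh, and the product of these factors
   over [t / h] steps stays bounded.  Only integrals of Gaussians times exponentials of
   linear functions occur, and these are Gaussians with a shifted centre. *)

Set Implicit Arguments.
Unset Strict Implicit.
Unset Printing Implicit Defensive.

Local Open Scope classical_set_scope.
Local Open Scope ring_scope.

(** * One-dimensional Gaussian kernels *)

(** Both factors at time [t1] depend on the same random point, so the expectation of their product
    is not a product of expectations. Each linear factor [u] is therefore replaced by
    [rho * expR (u / rho)], with [rho] the mean plus the fluctuation scale of that factor under the
    bridge. The product becomes an exponential of a linear function, its Gaussian integral is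
    explicit, and at this scale the exponent is bounded by an absolute constant. The balance [k]
    then controls the product of the two scales.

    A density is not a probability, so the indicator of a small cube around [y] is bounded by a
    multiple of a Gaussian of time [sg = l ^ 2], with a final bound independent of [l]. The
    enlargement [eps] keeps the half-space kernel comparable to the free one over this last time
    [sg <= eps ^ 2]; it costs only constant factors because [eps] is at most the distances involved.

    The image term of the half-space kernel is subtracted; it is moved to the other side, so that
    only integrals of nonnegative functions are compared. *)

Lemma measurable_EFin d (T : measurableType d) (R : realType) (D : set T)
    (g : T -> R) :
  measurable_fun D g -> measurable_fun D (fun x => (g x)%:E).
Proof. by move=> /measurable_EFinP. Qed.

Section gauss1.
Context {R : realType}.
Implicit Types (s t x y : R).

(** The variance [2 * t] matches the heat equation with the full Laplacian, not half of it. *)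
Definition gauss1 t x y : R := normal_pdf y (Num.sqrt (2 * t)) x.

Lemma gauss1E t x y : 0 < t ->
  gauss1 t x y = (Num.sqrt (4 * pi * t))^-1 * expR (- ((x - y) ^+ 2 / (4 * t))).
Proof.
move=> t0; have h : 0 <= 2 * t by rewrite mulr_ge0// ltW.
rewrite /gauss1 normal_pdfE; last by rewrite gt_eqF// sqrtr_gt0 mulr_gt0.
rewrite /normal_peak /normal_fun sqr_sqrtr//; congr (_ * _).
  by congr (Num.sqrt _)^-1; ring.
by congr expR; rewrite mulNr; congr (- (_ / _)); ring.
Qed.

Lemma gauss1_ge0 t x y : 0 <= gauss1 t x y.
Proof. exact: normal_pdf_ge0. Qed.

Lemma gauss1C t x y : 0 < t -> gauss1 t x y = gauss1 t y x.
Proof. by move=> t0; rewrite !gauss1E// -(opprB x y) sqrrN. Qed.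

Lemma measurable_gauss1l t y : measurable_fun setT (gauss1 t ^~ y).
Proof. exact: measurable_normal_pdf. Qed.

Lemma integral_gauss1 t y :
  (\int[lebesgue_measure]_x (gauss1 t x y)%:E = 1)%E.
Proof. exact: integral_normal_pdf. Qed.

(** Completing the square in [r]: the last factor is the density of the bridge from [x] to [y] at
    time [s], so integrating it out gives the semigroup property. *)
Lemma gauss1M s t x r y : 0 < s -> 0 < t ->
  gauss1 s x r * gauss1 t r y =
  gauss1 (s + t) x y * gauss1 (s * t / (s + t)) r ((t * x + s * y) / (s + t)).
Proof.
move=> s0 t0; have st0 : 0 < s + t by rewrite addr_gt0.
have p0 := pi_gt0 R.
have q0 : 0 < s * t / (s + t) by rewrite divr_gt0// mulr_gt0.
rewrite !gauss1E// mulrACA -expRD [RHS]mulrACA -expRD -!invfM -!sqrtrM; last first.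
- by rewrite !mulr_ge0// ltW.
- by rewrite !mulr_ge0// ltW.
congr (_^-1 * _).
  by congr Num.sqrt; field; rewrite gt_eqF.
by congr expR; field; rewrite !gt_eqF.
Qed.

Lemma integral_gauss1M s t x y : 0 < s -> 0 < t ->
  (\int[lebesgue_measure]_r (gauss1 s x r * gauss1 t r y)%:E =
   (gauss1 (s + t) x y)%:E)%E.
Proof.
move=> s0 t0; under eq_integral do rewrite gauss1M// EFinM.
rewrite ge0_integralZl_EFin ?gauss1_ge0//.
- by rewrite integral_gauss1 mule1.
- by move=> r _; rewrite lee_fin gauss1_ge0.
- by apply: measurable_EFin; exact: measurable_gauss1l.
Qed.

(** By uniqueness the Radon-Nikodym derivative of the law agrees almost everywhere with
    [normal_pdf]; finiteness of the integral supplies the integrability that the change of variables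
    requires. *)
Lemma integral_normal_prob (m s : R) (f : R -> R) :
  measurable_fun setT f -> (forall x, 0 <= f x) ->
  (\int[normal_prob m s]_x (f x)%:E < +oo)%E ->
  (\int[normal_prob m s]_x (f x)%:E =
   \int[lebesgue_measure]_x (f x * normal_pdf m s x)%:E)%E.
Proof.
move=> mf f0 foo; have dom := @normal_prob_dominates R m s.
rewrite -(Radon_Nikodym_change_of_variables dom)//=; last first.
  apply/integrableP; split; first exact: measurable_EFin.
  by under eq_integral do rewrite gee0_abs ?lee_fin//.
apply: ae_eq_integral => //.
- apply: emeasurable_funM; first exact: measurable_EFin.
  apply: (measurable_int lebesgue_measure).
  apply: (integrableS _ _ (@subsetT _ _)) => //=.
  by apply: Radon_Nikodym_integrable; exact: dom.
- apply: measurable_EFin; apply: measurable_funM => //; exact: measurable_normal_pdf.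
- rewrite (_ : (fun x => (f x * normal_pdf m s x)%:E) =
      (fun x => (f x)%:E * (normal_pdf m s x)%:E)%E); last first.
    by apply/funext => x; rewrite EFinM.
  apply: ae_eqe_mul2l => /=.
  rewrite Radon_NikodymE//=.
  case: cid => /= h [h1 h2 h3].
  apply: integral_ae_eq => //=.
  + by apply: measurable_EFin; exact: measurable_normal_pdf.
  + by move=> E E01 mE; rewrite -h3.
Qed.

Lemma gauss1_le t x y : 0 < t -> gauss1 t x y <= (Num.sqrt (4 * pi * t))^-1.
Proof.
move=> t0; rewrite gauss1E// ler_piMr ?invr_ge0 ?sqrtr_ge0//.
rewrite -expR0 ler_expR oppr_le0 divr_ge0 ?sqr_ge0// mulr_ge0// ltW//.
Qed.

Lemma gauss1_trans t x y w : 0 < t -> gauss1 t (y + x) w = gauss1 t (w - y) x.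
Proof.
move=> t0; rewrite !gauss1E// -(sqrrN (y + x - w)).
by have -> : - (y + x - w) = w - y - x by ring.
Qed.

Lemma integral_gauss1_normal_prob s h y w : 0 < s -> 0 < h ->
  (\int[normal_prob 0 (Num.sqrt (2 * h))]_g (gauss1 s (y + g) w)%:E =
   (gauss1 (s + h) y w)%:E)%E.
Proof.
move=> s0 h0; have mg : measurable_fun setT (fun g => gauss1 s (y + g) w).
  apply: (measurableT_comp (measurable_gauss1l _ _)) => //.
  exact: measurable_funD.
rewrite integral_normal_prob//.
- under eq_integral do rewrite gauss1_trans// -/(gauss1 h _ 0).
  rewrite integral_gauss1M// -[in RHS](addr0 y) [in RHS]gauss1_trans//.
  exact: addr_gt0.
- by move=> x; exact: gauss1_ge0.
- apply: (@le_lt_trans _ _ (\int[normal_prob 0 (Num.sqrt (2 * h))]_g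
    ((Num.sqrt (4 * pi * s))^-1)%:E)%E).
    apply: ge0_le_integral => //.
    + by move=> x _; rewrite lee_fin gauss1_ge0.
    + exact: measurable_EFin.
    + by move=> x _; rewrite lee_fin gauss1_le.
  by rewrite integral_cst// lte_mul_pinfty ?lee_fin ?invr_ge0 ?sqrtr_ge0//
    /= -ge0_fin_numE// fin_num_measure.
Qed.

End gauss1.

(** * Independent scalar increments *)

Lemma measurable_g_sigma_algebraType d (T : measurableType d) (U : pointedType)
    (G : set (set U)) (f : T -> g_sigma_algebraType G) :
  (forall C, G C -> measurable (f @^-1` C)) -> measurable_fun setT f.
Proof.
move=> mf; apply: (@measurability _ _ T (g_sigma_algebraType G) setT f G) => //.
by move=> _ [C GC <-]; rewrite setTI; exact: mf.
Qed.

Section past.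
Context d (Omega : measurableType d) (R : realType).
Variable g : nat -> Omega -> R.

(** Only a generator: these cylinders are stable under intersection and generate the past of the
    first [k] variables. Equipping [Omega] with that coarser sigma-algebra turns dependence on the
    past into plain measurability. *)
Definition past k : set (set Omega) :=
  [set C | exists2 A : nat -> set R, (forall i, measurable (A i)) &
    C = [set w | forall i, (i < k)%N -> A i (g i w)]].

Notation past_type k := (g_sigma_algebraType (past k)).

Lemma past_setI k : setI_closed (past k).
Proof.
move=> _ _ [A mA ->] [B mB ->]; exists (fun i => A i `&` B i).
  by move=> i; exact: measurableI.
by apply/seteqP; split=> [w [h1 h2] i ik|w h]; split=> //; [exact: h1|exact: h2| |];
  move=> i ik; have [] := h i ik.
Qed.

Lemma past_setT k : past k setT.
Proof. by exists (fun=> setT) => //; apply/seteqP; split. Qed.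

Definition past_measurable k (Z : Omega -> R) :=
  measurable_fun [set: past_type k] (Z : past_type k -> R).

Lemma past_measurable_coord k i : (i < k)%N -> past_measurable k (g i).
Proof.
move=> ik _ B mB; rewrite setTI; apply: sub_sigma_algebra.
exists (fun j => if j == i then B else setT).
  by move=> j; case: ifP.
apply/seteqP; split=> [w /= Bw j jk|w /= /(_ i ik)]; last by rewrite eqxx.
by case: eqP => // ->.
Qed.

Hypothesis mg : forall i, measurable_fun setT (g i).

Lemma past_sub k : past k `<=` measurable.
Proof.
move=> _ [A mA ->].
rewrite (_ : [set w | _] = \bigcap_(i in [set i | (i < k)%N]) (g i @^-1` A i)); last first.
  by apply/seteqP; split=> w /=.
apply: bigcap_measurableType => i _; rewrite -[X in measurable X]setTI; exact: mg.
Qed.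

Lemma measurable_past_id k : measurable_fun [set: Omega] (id : Omega -> past_type k).
Proof.
by apply: measurable_g_sigma_algebraType => C; exact: past_sub.
Qed.

Lemma past_measurableT k Z : past_measurable k Z -> measurable_fun setT Z.
Proof. 
move=> mZ _ B mB; have := mZ measurableT B mB; rewrite !setTI => mZB.
by have := @measurable_past_id k measurableT _ mZB; rewrite setTI. Qed.

Lemma past_measurableW k k' Z : (k <= k')%N -> past_measurable k Z ->
  past_measurable k' Z.
Proof.
move=> kk' mZ; suff mid : measurable_fun setT (id : past_type k' -> past_type k).
  move=> _ B mB; have := mZ measurableT B mB; rewrite !setTI => mZB.
  by have := mid measurableT _ mZB; rewrite setTI.
apply: measurable_g_sigma_algebraType => _ [A mA ->]; apply: sub_sigma_algebra.
exists (fun i => if (i < k)%N then A i else setT).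
  by move=> i; case: ifP.
apply/seteqP; split=> [w /= h i ik'|w /= h i ik].
  by case: ifP => // ik; exact: h.
by have := h i (leq_trans ik kk'); rewrite ik.
Qed.

End past.

Local Notation past_type g k := (g_sigma_algebraType (past g k)).

Section independence.
Context d (Omega : measurableType d) (R : realType) (P : probability Omega R).
Variables (g : nat -> Omega -> R) (k : nat) (mu : probability (measurableTypeR R) R).
Hypothesis mg : forall i, measurable_fun setT (g i).
Hypothesis gk_indep : forall (A : nat -> set R) B,
  (forall i, measurable (A i)) -> measurable B ->
  P ([set w | forall i, (i < k)%N -> A i (g i w)] `&` g k @^-1` B) =
  (P [set w | forall i, (i < k)%N -> A i (g i w)] * mu B)%E.

Let Om := past_type g k.

Let idm : Omega -> Om := id.
Let pairm : Omega -> (Om * measurableTypeR R)%type := fun w => (w, g k w).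

Let measurable_pairm : measurable_fun setT pairm.
Proof.
apply/measurable_fun_pairP; split => /=; last exact: mg.
exact: measurable_past_id.
Qed.

Let midm : measurable_fun setT idm.
Proof. exact: measurable_past_id. Qed.

Let idX : {mfun Omega >-> Om} := HB.pack idm (isMeasurableFun.Build _ _ _ _ _ midm).
Let pairX : {mfun Omega >-> (Om * measurableTypeR R)%type} :=
  HB.pack pairm (isMeasurableFun.Build _ _ _ _ _ measurable_pairm).

Let indep_past (A : set Om) (B : set (measurableTypeR R)) :
  measurable A -> measurable B -> P (A `&` g k @^-1` B) = (P A * mu B)%E.
Proof.
move=> mA mB.
have mgB : measurable (g k @^-1` B) by rewrite -[X in measurable X]setTI; exact: mg.
have muB0 : 0 <= fine (mu B) by rewrite fine_ge0.
have muBE : (fine (mu B))%:E = mu B by rewrite fineK// fin_num_measure.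
(* For fixed [B] both sides are finite measures in [A]. They agree on the cylinders, hence on the
   sigma-algebra these generate. *)
pose m1 := pushforward (mrestr P mgB) idX.
pose m2 := mscale (NngNum muB0) (distribution P idX).
suff : m1 A = m2 A.
  move=> h; rewrite [RHS]muleC.
  exact: (etrans h (congr1 (fun a => a * _)%E muBE)).
apply: (@measure_unique _ R Om (past g k) (fun=> setT) _ _ _ _ m1 m2) => //.
- exact: past_setI.
- by move=> _; exact: past_setT.
- by rewrite bigcup_const//; exists 0%N.
- move=> _ [C mC ->]; rewrite /m1 /m2 /mscale /= /distribution /pushforward /mrestr /=.
  rewrite gk_indep// muleC; exact: (congr1 (fun a => a * _)%E (esym muBE)).
- move=> _; rewrite /m1 /pushforward /mrestr /= -ge0_fin_numE ?measure_ge0//.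
  by rewrite fin_num_measure// preimage_setT.
Qed.

(** With the past sigma-algebra on the first coordinate, the law of the pair [(w, g k w)] is a
    product measure, so by Tonelli the new variable is integrated first with the past frozen. *)
Lemma integral_indep (F : past_type g k * R -> \bar R) :
  measurable_fun setT (F : past_type g k * measurableTypeR R -> \bar R) ->
  (forall z, 0 <= F z)%E ->
  (\int[P]_w F (w, g k w) = \int[P]_w \int[mu]_r F (w, r))%E.
Proof.
move=> mF F0.
transitivity (\int[distribution P pairX]_z F z)%E.
  by rewrite ge0_integral_distribution.
transitivity (\int[distribution P idX \x mu]_z F z)%E.
  apply: eq_measure_integral => X mX _; apply/esym.
  by apply: product_measure_unique => // A B mA mB; exact: indep_past.
rewrite fubini_tonelli1// ge0_integral_distribution//.
  exact: measurable_fun_fubini_tonelli_F.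
by move=> w; apply: integral_ge0.
Qed.

End independence.

(** * The heat kernel on R^n *)

Section dotv.
Context {R : realType} {n : nat}.
Implicit Types (x y z v e : 'rV[R]_n).

Lemma dotvC x y : dotv x y = dotv y x.
Proof. by apply: eq_bigr => i _; rewrite mulrC. Qed.

Lemma dotvDl x y z : dotv (x + y) z = dotv x z + dotv y z.
Proof. by rewrite -big_split/=; apply: eq_bigr => i _; rewrite mxE mulrDl. Qed.

Lemma dotvZl (a : R) x y : dotv (a *: x) y = a * dotv x y.
Proof. by rewrite mulr_sumr; apply: eq_bigr => i _; rewrite mxE mulrA. Qed.

Lemma dotvNl x y : dotv (- x) y = - dotv x y.
Proof. by rewrite -scaleN1r dotvZl mulN1r. Qed.

Lemma dotvDr x y z : dotv x (y + z) = dotv x y + dotv x z.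
Proof. by rewrite dotvC dotvDl !(dotvC x). Qed.

Lemma dotvZr (a : R) x y : dotv x (a *: y) = a * dotv x y.
Proof. by rewrite dotvC dotvZl dotvC. Qed.

Lemma dotvNr x y : dotv x (- y) = - dotv x y.
Proof. by rewrite dotvC dotvNl dotvC. Qed.

Definition dotvE := (dotvDl, dotvDr, dotvZl, dotvZr, dotvNl, dotvNr).

Lemma dotv_ge0 x : 0 <= dotv x x.
Proof. by apply: sumr_ge0 => i _; rewrite -expr2 sqr_ge0. Qed.

Lemma sqr_enorm x : enorm x ^+ 2 = dotv x x.
Proof. by rewrite sqr_sqrtr// dotv_ge0. Qed.

Lemma dotv_unit_sqr e x : dotv e e = 1 -> dotv e x ^+ 2 <= dotv x x.
Proof.
move=> e1; have := dotv_ge0 (x - dotv e x *: e).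
rewrite !dotvE e1 (dotvC x e); nra.
Qed.

Lemma dotv_unit_le1 e v : dotv e e = 1 -> dotv v v = 1 -> dotv e v <= 1.
Proof. by move=> e1 v1; have := dotv_unit_sqr v e1; rewrite v1; nra. Qed.

Lemma dotv_unit_le e x : dotv e e = 1 -> dotv e x <= enorm x.
Proof.
move=> e1; rewrite (le_trans (ler_norm _))// -sqrtr_sqr ler_wsqrtr//.
exact: dotv_unit_sqr.
Qed.

End dotv.

Section heat_kernel.
Context {R : realType} {n : nat}.
Implicit Types (s t : R) (x y z v : 'rV[R]_n).

Lemma heat_kernel_prod t x y : 0 < t ->
  heat_kernel t x y = \prod_(i < n) gauss1 t (x 0 i) (y 0 i).
Proof.
move=> t0; have q0 : 0 <= 4 * pi * t.
  by rewrite mulr_ge0 ?mulr_ge0 ?pi_ge0// ltW.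
under eq_bigr do rewrite gauss1E//.
rewrite big_split/= -expR_sum prodr_const card_ord; congr (_ * _).
  by rewrite powRN (mulrC n%:R) powRrM powR12_sqrt// powR_mulrn ?sqrtr_ge0// exprVn.
rewrite sqr_enorm; congr expR; rewrite sumrN -mulr_suml.
by congr (- (_ * _)); apply: eq_bigr => i _; rewrite !mxE expr2.
Qed.

Lemma heat_kernel_ge0 t x y : 0 <= heat_kernel t x y.
Proof. by rewrite mulr_ge0 ?powR_ge0 ?expR_ge0. Qed.

Lemma heat_kernel_le t x y : 0 < t ->
  heat_kernel t x y <= (4 * pi * t) `^ (- (n%:R / 2)).
Proof.
move=> t0; rewrite ler_piMr ?powR_ge0// -expR0 ler_expR oppr_le0.
by rewrite divr_ge0 ?sqr_ge0 ?mulr_ge0 ?ltW.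
Qed.

(** Moving the endpoint multiplies the kernel by the exponential of an affine function of the
    starting point. The reflection and tilt identities below are instances. *)
Lemma heat_kernel_shift t x y v : 0 < t ->
  heat_kernel t x (y + v) =
  heat_kernel t x y * expR (dotv v (x - y) / (2 * t) - dotv v v / (4 * t)).
Proof.
move=> t0; rewrite /heat_kernel -[RHS]mulrA -expRD; congr (_ * expR _).
rewrite !sqr_enorm opprD addrA !dotvE.
by rewrite (dotvC y v) (dotvC x v) (dotvC y x); field; rewrite gt_eqF.
Qed.

End heat_kernel.

(** * Gaussian random walks *)

Lemma measurable_funP_prod d (T : measurableType d) (R : realType) I (s : seq I)
    (p : pred I) (h : I -> T -> R) :
  (forall i, p i -> measurable_fun setT (h i)) ->
  measurable_fun setT (fun x => \prod_(i <- s | p i) h i x).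
Proof.
move=> mh; elim: s => [|i s ih]; first by under eq_fun do rewrite big_nil; exact: measurable_cst.
have [pi|/negbTE pi] := boolP (p i); under eq_fun do rewrite big_cons pi.
  by apply: measurable_funM => //; exact: mh.
exact: ih.
Qed.

Section gaussian_step.
Context d (Omega : measurableType d) (R : realType) (P : probability Omega R).
Variables (g : nat -> Omega -> R) (k : nat) (h : R).
Hypothesis mg : forall i, measurable_fun setT (g i).
Hypothesis h0 : 0 < h.
Hypothesis gk_indep : forall (A : nat -> set R) B,
  (forall i, measurable (A i)) -> measurable B ->
  P ([set w | forall i, (i < k)%N -> A i (g i w)] `&` g k @^-1` B) =
  (P [set w | forall i, (i < k)%N -> A i (g i w)] *
   normal_prob 0 (Num.sqrt (2 * h)) B)%E.

Lemma integral_gauss1_step (Z Y : Omega -> R) s y :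
  past_measurable g k Z -> past_measurable g k Y -> (forall w, 0 <= Z w) -> 0 < s ->
  (\int[P]_w (Z w * gauss1 s (Y w + g k w) y)%:E =
   \int[P]_w (Z w * gauss1 (s + h) (Y w) y)%:E)%E.
Proof.
move=> mZ mY Z0 s0.
pose F (z : past_type g k * R) := (Z z.1 * gauss1 s (Y z.1 + z.2) y)%:E.
have mYD : measurable_fun [set: past_type g k * measurableTypeR R]
    (fun z : past_type g k * measurableTypeR R => Y z.1 + z.2).
  apply: measurable_funD; last exact: measurable_snd.
  exact: (measurableT_comp mY measurable_fst).
have mF : measurable_fun [set: past_type g k * measurableTypeR R]
    (F : past_type g k * measurableTypeR R -> \bar R).
  apply: measurable_EFin; apply: measurable_funM.
    exact: (measurableT_comp mZ measurable_fst).
  exact: (measurableT_comp (measurable_gauss1l s y) mYD).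
have F0 z : (0 <= F z)%E by rewrite lee_fin mulr_ge0// gauss1_ge0.
rewrite (integral_indep mg gk_indep mF F0).
apply: eq_integral => w _; rewrite /F /=.
under eq_integral do rewrite EFinM.
rewrite ge0_integralZl_EFin//.
- by rewrite integral_gauss1_normal_prob.
- by move=> r _; rewrite lee_fin gauss1_ge0.
- apply: measurable_EFin.
  apply: (measurableT_comp (measurable_gauss1l s y)) => //.
  exact: measurable_funD.
Qed.

End gaussian_step.

Section gaussian_walk.
Context (R : realType) (n : nat) d (Omega : measurableType d).
Variables (P : probability Omega R).

(* The scalar increments are numbered [j * n + i], time first. *)
Record gaussian_walk (g : nat -> Omega -> R) (h : nat -> R) (N : nat)
    (X : nat -> Omega -> 'rV[R]_n) : Prop := GaussianWalk {
  walk_measurable : forall i, measurable_fun setT (g i) ;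
  walk_start : exists x, forall w, X 0%N w = x ;
  walk_step : forall j w i, X j.+1 w 0 i = X j w 0 i + g (j * n + i)%N w ;
  walk_h0 : forall j, 0 < h j ;
  walk_indep : forall k (A : nat -> set R) B, (k < N * n)%N ->
    (forall i, measurable (A i)) -> measurable B ->
    P ([set w | forall i, (i < k)%N -> A i (g i w)] `&` g k @^-1` B) =
    (P [set w | forall i, (i < k)%N -> A i (g i w)] *
     normal_prob 0 (Num.sqrt (2 * h (k %/ n)%N)) B)%E }.

Variables (g : nat -> Omega -> R) (h : nat -> R) (N : nat)
  (X : nat -> Omega -> 'rV[R]_n).
Hypothesis walk : gaussian_walk g h N X.

Definition walk_past j (Z : Omega -> R) := past_measurable g (j * n) Z.

Lemma walk_past_coord k j i : (j * n <= k)%N ->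
  past_measurable g k (fun w => X j w 0 i).
Proof.
elim: j k i => [|j IH] k i jk.
  have [x Xx] := walk_start walk.
  rewrite (_ : (fun w => _) = cst (x 0 i)); first exact: measurable_cst.
  by apply/funext => w; rewrite Xx.
rewrite (_ : (fun w => _) = fun w => X j w 0 i + g (j * n + i)%N w); last first.
  by apply/funext => w; rewrite (walk_step walk).
apply: measurable_funD.
  by apply: IH; rewrite (leq_trans _ jk)// leq_mul2r leqnSn orbT.
by apply: past_measurable_coord; rewrite (leq_trans _ jk)// mulSnr ltn_add2l.
Qed.

Lemma past_measurable_heat_kernel k j s y : 0 < s -> (j * n <= k)%N ->
  past_measurable g k (fun w => heat_kernel s (X j w) y).
Proof.
move=> s0 jk.
rewrite (_ : (fun w => _) = fun w => \prod_(i < n) gauss1 s (X j w 0 i) (y 0 i)); last first.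
  by apply/funext => w; rewrite heat_kernel_prod.
apply: measurable_funP_prod => i _.
exact: (measurableT_comp (measurable_gauss1l s _) (walk_past_coord _ jk)).
Qed.

Lemma past_measurable_dotv k j y : (j * n <= k)%N ->
  past_measurable g k (fun w => dotv y (X j w)).
Proof.
move=> jk; apply: measurable_sum => i.
by apply: measurable_funM => //; exact: walk_past_coord.
Qed.

Lemma integral_heat_kernel_step (Z : Omega -> R) j s y : (j < N)%N ->
  walk_past j Z -> (forall w, 0 <= Z w) -> 0 < s ->
  (\int[P]_w (Z w * heat_kernel s (X j.+1 w) y)%:E =
   \int[P]_w (Z w * heat_kernel (s + h j) (X j w) y)%:E)%E.
Proof.
move=> jN mZ Z0 s0; have hj0 := walk_h0 walk j; have sh0 := addr_gt0 s0 hj0.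
(* Hybrid products: the first [m] coordinates use the new position and time [s], the others the old
   position and time [s + h j]. Lowering [m] by one integrates out one scalar increment. *)
pose G m (i : 'I_n) w := if (i < m)%N then gauss1 s (X j.+1 w 0 i) (y 0 i)
  else gauss1 (s + h j) (X j w 0 i) (y 0 i).
have G0 m i w : 0 <= G m i w by rewrite /G; case: ifP; rewrite gauss1_ge0.
suff step m : (m < n)%N ->
    (\int[P]_w (Z w * \prod_(i < n) G m.+1 i w)%:E =
     \int[P]_w (Z w * \prod_(i < n) G m i w)%:E)%E.
  have {step} step m : (m <= n)%N ->
      (\int[P]_w (Z w * \prod_(i < n) G m i w)%:E =
       \int[P]_w (Z w * \prod_(i < n) G 0%N i w)%:E)%E.
    elim: m => // m IH mn; rewrite step// IH//; exact: ltnW.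
  have Gn w : \prod_(i < n) G n i w = heat_kernel s (X j.+1 w) y.
    by rewrite heat_kernel_prod//; apply: eq_bigr => i _; rewrite /G ltn_ord.
  have G_0 w : \prod_(i < n) G 0%N i w = heat_kernel (s + h j) (X j w) y.
    by rewrite heat_kernel_prod.
  have := step n (leqnn n).
  by under eq_integral do rewrite Gn; under [X in _ = X -> _]eq_integral do rewrite G_0.
move=> mn; pose i0 := Ordinal mn.
(* The factors with index below [m] involve only increments that precede the scalar numbered
   [j * n + m], so they can be frozen together with [Z]. *)
pose Z' w := Z w * \prod_(i < n | i != i0) G m i w.
have GE w : \prod_(i < n | i != i0) G m.+1 i w = \prod_(i < n | i != i0) G m i w.
  apply: eq_bigr => i ii0; rewrite /G ltnS leq_eqVlt.
  by rewrite (_ : (i == m :> nat) = false)//; apply/negbTE.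
transitivity (\int[P]_w (Z' w * gauss1 s (X j w 0 i0 + g (j * n + m)%N w) (y 0 i0))%:E)%E.
  apply: eq_integral => w _; rewrite (bigD1 i0)//= GE mulrCA mulrC /Z'.
  by congr (_ * _)%:E; rewrite /G /= ltnSn (walk_step walk).
have jnm : (j * n <= j * n + m)%N by rewrite leq_addr.
rewrite (@integral_gauss1_step _ _ _ _ g (j * n + m) (h j))//.
- apply: eq_integral => w _; rewrite (bigD1 i0)//= mulrCA mulrC /Z'.
  by congr (_ * _)%:E; rewrite /G /= ltnn.
- exact: walk_measurable walk.
- move=> A B mA mB; have /(walk_indep walk) : (j * n + m < N * n)%N.
    by rewrite (@leq_trans (j.+1 * n))// ?leq_mul2r ?jN ?orbT// mulSnr ltn_add2l.
  move=> /(_ A B mA mB) ->.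
  suff -> : ((j * n + m) %/ n)%N = j by [].
  by rewrite divnMDl ?divn_small ?addn0// (leq_ltn_trans _ mn).
- apply: measurable_funM; first exact: past_measurableW mZ.
  apply: measurable_funP_prod => i ii0; have [im|im] := boolP (i < m)%N.
    rewrite (_ : G m i = fun w => gauss1 s (X j w 0 i + g (j * n + i)%N w) (y 0 i)); last first.
      by apply/funext => w; rewrite /G im (walk_step walk).
    apply: (measurableT_comp (measurable_gauss1l s _)).
    apply: measurable_funD; first exact: walk_past_coord.
    by apply: past_measurable_coord; rewrite ltn_add2l.
  rewrite (_ : G m i = fun w => gauss1 (s + h j) (X j w 0 i) (y 0 i)); last first.
    by apply/funext => w; rewrite /G (negbTE im).
  exact: (measurableT_comp (measurable_gauss1l _ _) (walk_past_coord _ jnm)).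
- exact: walk_past_coord.
- by move=> w; rewrite mulr_ge0// prodr_ge0.
Qed.

End gaussian_walk.

(** * Reflected kernels in a half-space *)

Section halfspace_kernel.
Context {R : realType} {n : nat}.
Implicit Types (s t c eps : R) (x y z w e : 'rV[R]_n).

(** For a unit vector [e], the Dirichlet kernel of the half-space [c < dotv e z] by the method of
    images: by [heat_kernel_reflect] the subtracted term is the free kernel at the mirror image of
    [w]. *)
Definition hs_kernel e c s z w : R :=
  heat_kernel s z w * (1 - expR (- ((dotv e z - c) * (dotv e w - c) / s))).

Definition hs_ind e c z : R := (c < dotv e z)%R%:R.

Lemma hs_ind_ge0 e c z : 0 <= hs_ind e c z. Proof. exact: ler0n. Qed.

Lemma hs_ind_le1 e c z : hs_ind e c z <= 1. Proof. by rewrite lern1 leq_b1. Qed.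

Lemma heat_kernel_reflect e c s z w : dotv e e = 1 -> 0 < s ->
  heat_kernel s z (w - (2 * (dotv e w - c)) *: e) =
  heat_kernel s z w * expR (- ((dotv e z - c) * (dotv e w - c) / s)).
Proof.
move=> e1 s0; rewrite heat_kernel_shift//; congr (_ * expR _).
by rewrite !dotvE e1; field; rewrite gt_eqF.
Qed.

Lemma heat_kernel_tilt e s t th z w : dotv e e = 1 -> 0 < s ->
  heat_kernel s z (w - (2 * t * th) *: e) =
  heat_kernel s z w *
    expR (- (t * th * (dotv e z - dotv e w + t * th) / s)).
Proof.
move=> e1 s0; rewrite heat_kernel_shift//; congr (_ * expR _).
by rewrite !dotvE e1; field; rewrite gt_eqF.
Qed.

Lemma hs_kernel_ge0 e c s z w : 0 < s -> 0 <= dotv e z - c -> 0 <= dotv e w - c ->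
  0 <= hs_kernel e c s z w.
Proof.
move=> s0 z0 w0; rewrite mulr_ge0 ?heat_kernel_ge0// subr_ge0 -expR0 ler_expR.
by rewrite oppr_le0 divr_ge0 ?mulr_ge0// ltW.
Qed.

Lemma hs_kernel_le e c s z w : 0 < s ->
  hs_kernel e c s z w <=
  heat_kernel s z w * ((dotv e z - c) * (dotv e w - c) / s).
Proof.
move=> s0; rewrite ler_wpM2l ?heat_kernel_ge0//.
by rewrite lerBlDr addrC -lerBlDr expR_ge1Dx.
Qed.

Lemma hs_kernel_le1 e c s z w : hs_kernel e c s z w <= heat_kernel s z w.
Proof. by rewrite ler_piMr ?heat_kernel_ge0// gerBl expR_ge0. Qed.

(** Both points are at distance at least [eps] from the enlarged hyperplane, so the exponent of the
    image term is at most -1, and this term removes at most half of the kernel. *)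
Lemma heat_kernel_le_hs e c eps s z w : 0 < s -> 0 < eps -> s <= eps ^+ 2 ->
  c <= dotv e z -> c <= dotv e w ->
  heat_kernel s z w <= 2 * hs_kernel e (c - eps) s z w.
Proof.
move=> s0 eps0 seps cz cw; rewrite mulrCA ler_peMr ?heat_kernel_ge0//.
have h1 : expR (-1) <= 2^-1 :> R.
  by rewrite expRN lef_pV2 ?posrE ?expR_gt0//; have := @expR_ge1Dx R 1; lra.
have h2 : expR (- ((dotv e z - (c - eps)) * (dotv e w - (c - eps)) / s)) <= expR (-1) :> R.
  rewrite ler_expR lerN2 ler_pdivlMr// mul1r (le_trans seps)// expr2.
  by rewrite ler_pM ?(ltW eps0)//; lra.
lra.
Qed.

(* The left-hand side is [heat_kernel * 1_H (1 - a) + heat_kernel * a] with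
   [a = expR (- b D / s)]; the correction [expR (- th D)] beats [a - 1] where [D < 0]. *)
Lemma hs_kernel_dominate e c eps s lam z w (b := dotv e w - (c - eps))
    (th := b / s + lam) : dotv e e = 1 -> 0 < s -> 0 <= eps ->
  0 <= lam -> c <= dotv e w ->
  hs_ind e c z * hs_kernel e (c - eps) s z w +
  heat_kernel s z (w - (2 * b) *: e) <=
  heat_kernel s z w +
  expR (- (th * b) + s * th ^+ 2) * heat_kernel s z (w - (2 * s * th) *: e).
Proof.
move=> e1 s0 eps0 lam0 cw.
rewrite (@heat_kernel_reflect e (c - eps))// heat_kernel_tilt//.
set D := dotv e z - (c - eps).
rewrite [expR _ * _]mulrCA -expRD (_ : _ + _ + _ = - (th * D)); last first.
  by rewrite /D /b; field; rewrite gt_eqF.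
rewrite /hs_kernel -/D -/b; set a := expR (- (D * b / s)).
rewrite mulrCA -mulrDr -[X in _ <= X + _]mulr1 -mulrDr.
rewrite ler_wpM2l ?heat_kernel_ge0//.
have b0 : 0 <= b by rewrite /b; lra.
have bs0 : 0 <= b / s by rewrite divr_ge0// ltW.
have e0 := expR_ge0 (- (th * D)).
rewrite /hs_ind; case: ltP => [_|zc] /=; first by rewrite mul1r; lra.
rewrite mul0r add0r; have [D0|D0] := leP 0 D.
  have : a <= 1 by rewrite -expR0 ler_expR oppr_le0 -mulrA mulr_ge0.
  lra.
have : a <= expR (- (th * D)) by rewrite ler_expR /th -mulrA; nra.
lra.
Qed.

(** With a general [lam] in place of [eps / (2 * h)], the collected exponent is
    [- (s * th * (D - lam * h) / (s + h))], where [D >= eps]. Since [s * th >= s * lam], the choice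
    made here is the one that maximizes [lam * (eps - lam * h)]; then [h <= s] leaves
    [eps ^ 2 / (8 * h)]. The denominator is a lower bound for the image factor of the kernel at time
    [s + h]. *)
Lemma hs_correction_le e c eps s h tau z w (b := dotv e w - (c - eps))
    (th := b / s + eps / (2 * h)) : dotv e e = 1 -> 0 < s -> 0 < h ->
  h <= s -> s + h <= tau -> 0 < eps -> c <= dotv e w -> c <= dotv e z ->
  expR (- (th * b) + s * th ^+ 2) * heat_kernel (s + h) z (w - (2 * s * th) *: e)
  <= expR (- (eps ^+ 2 / (8 * h))) / (1 - expR (- (eps ^+ 2 / tau))) *
     hs_kernel e (c - eps) (s + h) z w.
Proof.
move=> e1 s0 h0 hs tau0 eps0 cw cz.
have sh0 := addr_gt0 s0 h0; have t0 := lt_le_trans sh0 tau0.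
rewrite heat_kernel_tilt//.
set D := dotv e z - (c - eps).
have b_eps : eps <= b by rewrite /b; lra.
have D_eps : eps <= D by rewrite /D; lra.
rewrite [expR _ * _]mulrCA -expRD /hs_kernel -/D -/b.
rewrite [leRHS]mulrCA ler_wpM2l ?heat_kernel_ge0// -[leRHS]mulrA.
have k0 : 0 < 1 - expR (- (eps ^+ 2 / tau)).
  by rewrite subr_gt0 expR_lt1 oppr_lt0 divr_gt0 ?exprn_gt0.
have h1 : 1 <= (1 - expR (- (eps ^+ 2 / tau)))^-1 * (1 - expR (- (D * b / (s + h)))).
  rewrite mulrC ler_pdivlMr// mul1r lerD2l lerN2 ler_expR lerN2.
  rewrite ler_pM// ?sqr_ge0// ?invr_ge0 ?(ltW t0)//.
    by rewrite expr2 ler_pM ?(ltW eps0).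
  by rewrite lef_pV2.
rewrite (@le_trans _ _ (expR (- (eps ^+ 2 / (8 * h)))))//; last first.
  by rewrite ler_peMr ?expR_ge0.
rewrite ler_expR.
have -> : - (th * b) + s * th ^+ 2 +
    - (s * th * (dotv e z - dotv e w + s * th) / (s + h)) =
    - ((b + eps / (2 * h) * s) * (D - eps / 2) / (s + h)).
  by rewrite /th /D /b; field; rewrite !gt_eqF.
rewrite lerN2 ler_pdivlMr//.
have h2 : eps / (2 * h) * s * (eps / 2) <= (b + eps / (2 * h) * s) * (D - eps / 2).
  have g0 : 0 <= eps / (2 * h) * s by rewrite mulr_ge0 ?divr_ge0 ?mulr_ge0 ?ltW.
  by apply: ler_pM; lra.
apply: le_trans h2.
have -> : eps ^+ 2 / (8 * h) * (s + h) = eps ^+ 2 / (8 * h) * s + eps ^+ 2 / 8.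
  by field; rewrite gt_eqF.
have -> : eps / (2 * h) * s * (eps / 2) = eps ^+ 2 / (8 * h) * s + eps ^+ 2 / (8 * h) * s.
  by field; rewrite gt_eqF.
rewrite lerD2l (_ : eps ^+ 2 / 8 = eps ^+ 2 / (8 * h) * h); last first.
  by field; rewrite gt_eqF.
by rewrite ler_wpM2l// divr_ge0 ?sqr_ge0 ?mulr_ge0 ?ltW.
Qed.

End halfspace_kernel.

(** * One Gaussian step of the half-space kernel *)

Section hs_walk.
Context (R : realType) (n : nat) d (Omega : measurableType d).
Variables (P : probability Omega R) (g : nat -> Omega -> R) (h : nat -> R)
  (N : nat) (X : nat -> Omega -> 'rV[R]_n).
Hypothesis walk : gaussian_walk P g h N X.
Implicit Types (e y : 'rV[R]_n) (c eps s tau : R).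

Lemma past_measurable_hs_ind k j e c : (j * n <= k)%N ->
  past_measurable g k (fun w => hs_ind e c (X j w)).
Proof.
move=> jk.
rewrite (_ : (fun w => _) = fun w => if c < dotv e (X j w) then 1 else 0 :> R); last first.
  by apply/funext => w; rewrite /hs_ind; case: ifP.
apply: measurable_fun_ifT => //; apply: measurable_fun_ltr => //.
exact: (past_measurable_dotv walk).
Qed.

Lemma past_measurable_hs_kernel k j e c s y : 0 < s -> (j * n <= k)%N ->
  past_measurable g k (fun w => hs_kernel e c s (X j w) y).
Proof.
move=> s0 jk; apply: measurable_funM; first exact: (past_measurable_heat_kernel walk).
apply: measurable_funB => //; apply: measurableT_comp => //.
apply: measurable_funN; apply: measurable_funM => //; apply: measurable_funM => //.
by apply: measurable_funB => //; exact: (past_measurable_dotv walk).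
Qed.

Let mX Z k : past_measurable g k Z -> measurable_fun setT Z.
Proof. exact: past_measurableT (walk_measurable walk) _ _. Qed.

Lemma integral_heat_kernel_lty (Z : Omega -> R) j s y :
  measurable_fun setT Z -> (forall w, 0 <= Z w <= 1) -> 0 < s ->
  (\int[P]_w (Z w * heat_kernel s (X j w) y)%:E < +oo)%E.
Proof.
move=> mZ Z01 s0.
apply: (@le_lt_trans _ _ (\int[P]_w ((4 * pi * s) `^ (- (n%:R / 2)))%:E)%E).
  apply: ge0_le_integral => //.
  - by move=> w _; have /andP[? ?] := Z01 w; rewrite lee_fin mulr_ge0// heat_kernel_ge0.
  - apply: measurable_EFin; apply: measurable_funM => //.
    exact: mX (past_measurable_heat_kernel walk _ s0 (leqnn _)).
  - move=> w _; rewrite lee_fin -[leRHS]mul1r; have /andP[? ?] := Z01 w.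
    by rewrite ler_pM ?heat_kernel_ge0// heat_kernel_le.
by rewrite integral_cst//= (@probability_setT _ _ _ P) mule1 ltry.
Qed.

(** The approximate supersolution property. The indicator at time [j] places the start of the step
    inside the half-space, where the correction is at most [eta] times the kernel itself. *)
Lemma integral_hs_step (Z : Omega -> R) j e c eps s tau eta y : (j < N)%N ->
  walk_past n g j Z -> (forall w, 0 <= Z w <= 1) ->
  dotv e e = 1 -> 0 < eps -> 0 < s -> h j <= s -> s + h j <= tau -> c <= dotv e y ->
  expR (- (eps ^+ 2 / (8 * h j))) / (1 - expR (- (eps ^+ 2 / tau))) <= eta ->
  (\int[P]_w (Z w * hs_ind e c (X j w) *
     (hs_ind e c (X j.+1 w) * hs_kernel e (c - eps) s (X j.+1 w) y))%:E <=
   (1 + eta)%:E * \int[P]_w (Z w * (hs_ind e c (X j w) *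
     hs_kernel e (c - eps) (s + h j) (X j w) y))%:E)%E.
Proof.
move=> jN mZ Z01 e1 eps0 s0 hs stau cy eta_ge.
have h0 := walk_h0 walk j; have sh0 := addr_gt0 s0 h0.
have eta0 : 0 <= eta.
  apply: le_trans eta_ge; rewrite divr_ge0 ?expR_ge0// subr_ge0 -expR0 ler_expR.
  by rewrite oppr_le0 divr_ge0 ?sqr_ge0// (le_trans (ltW sh0)).
set b := dotv e y - (c - eps); pose th := b / s + eps / (2 * h j).
pose K := expR (- (th * b) + s * th ^+ 2).
pose y1 := y - (2 * b) *: e; pose y2 := y - (2 * s * th) *: e.
pose Z1 w := Z w * hs_ind e c (X j w).
have K0 : 0 <= K by exact: expR_ge0.
have Z10 w : 0 <= Z1 w by have /andP[? ?] := Z01 w; rewrite mulr_ge0// hs_ind_ge0.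
have Z11 w : 0 <= Z1 w <= 1.
  by rewrite Z10 -[leRHS]mulr1; have /andP[? ?] := Z01 w; rewrite ler_pM ?hs_ind_ge0 ?hs_ind_le1.
have pZ1 : walk_past n g j Z1.
  by apply: measurable_funM => //; exact: past_measurable_hs_ind.
have mZ1 := mX pZ1.
have mhk i t v : 0 < t -> measurable_fun setT (fun w => Z1 w * heat_kernel t (X i w) v).
  move=> t0; apply: measurable_funM => //.
  exact: mX (past_measurable_heat_kernel walk _ t0 (leqnn _)).
have mhs i t : 0 < t -> measurable_fun setT (fun w =>
    hs_ind e c (X i w) * hs_kernel e (c - eps) t (X i w) y).
  move=> t0; apply: measurable_funM.
    exact: mX (past_measurable_hs_ind _ _ (leqnn _)).
  exact: mX (past_measurable_hs_kernel _ _ _ t0 (leqnn _)).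
have hs0 t i w : 0 < t -> 0 <= hs_ind e c (X i w) * hs_kernel e (c - eps) t (X i w) y.
  move=> t0; rewrite /hs_ind; case: ltP => [cX|]; last by rewrite mul0r.
  by rewrite mul1r hs_kernel_ge0//; lra.
have hk0 i t v w : 0 <= Z1 w * heat_kernel t (X i w) v.
  by rewrite mulr_ge0// heat_kernel_ge0.
set I1 := (X in (X <= _)%E).
(* The image term is added to both sides to make every integrand nonnegative; being finite, it can
   be cancelled. *)
pose B := (\int[P]_w (Z1 w * heat_kernel (s + h j) (X j w) y1)%:E)%E.
have B0 : (0 <= B)%E by apply: integral_ge0 => w _; rewrite lee_fin.
have Bfin : B \is a fin_num by rewrite ge0_fin_numE// integral_heat_kernel_lty.
rewrite -(leeD2rE _ _ Bfin).
have -> : (I1 + B = \int[P]_w (Z1 w * (hs_ind e c (X j.+1 w) *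
    hs_kernel e (c - eps) s (X j.+1 w) y) + Z1 w * heat_kernel s (X j.+1 w) y1)%:E)%E.
  under [RHS]eq_integral do rewrite EFinD.
  rewrite (ge0_integralD P measurableT).
  - by rewrite (integral_heat_kernel_step walk _ jN pZ1).
  - by move=> w _; rewrite lee_fin mulr_ge0// hs0.
  - by apply: measurable_EFin; apply: measurable_funM => //; exact: mhs.
  - by move=> w _; rewrite lee_fin.
  - by apply: measurable_EFin; exact: mhk.
apply: (@le_trans _ _ (\int[P]_w (Z1 w * heat_kernel s (X j.+1 w) y +
    K * (Z1 w * heat_kernel s (X j.+1 w) y2))%:E)%E).
  apply: ge0_le_integral => //.
  - by move=> w _; rewrite lee_fin addr_ge0// mulr_ge0// hs0.
  - apply: measurable_EFin; apply: measurable_funD; last exact: mhk.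
    by apply: measurable_funM => //; exact: mhs.
  - apply: measurable_EFin; apply: measurable_funD; first exact: mhk.
    by apply: measurable_funM => //; exact: mhk.
  - move=> w _; rewrite lee_fin [K * _]mulrCA -!mulrDr ler_wpM2l//.
    have lam0 : 0 <= eps / (2 * h j) by rewrite divr_ge0 ?mulr_ge0 ?ltW.
    exact: (hs_kernel_dominate (X j.+1 w) e1 s0 (ltW eps0) lam0 cy).
have DK i t : 0 < t -> (\int[P]_w (Z1 w * heat_kernel t (X i w) y +
    K * (Z1 w * heat_kernel t (X i w) y2))%:E =
    \int[P]_w (Z1 w * heat_kernel t (X i w) y)%:E +
    K%:E * \int[P]_w (Z1 w * heat_kernel t (X i w) y2)%:E)%E.
  move=> t0; under eq_integral do rewrite EFinD [X in (_ + X)%E]EFinM.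
  rewrite ge0_integralD//.
  - rewrite ge0_integralZl_EFin//; first by move=> w _; rewrite lee_fin.
    by apply: measurable_EFin; exact: mhk.
  - by move=> w _; rewrite lee_fin.
  - by apply: measurable_EFin; exact: mhk.
  - by move=> w _; rewrite -EFinM lee_fin mulr_ge0.
  - apply: (@measurable_EFin _ _ _ _ (fun w => K * _)).
    by apply: measurable_funM => //; exact: mhk.
(* Only free kernels are left on the right, so the step is integrated exactly and turns time [s]
   into [s + h j]. *)
rewrite (DK _ _ s0) (integral_heat_kernel_step walk y jN pZ1 Z10 s0).
rewrite (integral_heat_kernel_step walk y2 jN pZ1 Z10 s0) -(DK _ _ sh0).
have mZhs : measurable_fun setT (fun w => Z w * (hs_ind e c (X j w) *
    hs_kernel e (c - eps) (s + h j) (X j w) y)).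
  by apply: measurable_funM; [exact: mX mZ|exact: mhs].
have Zhs0 w : 0 <= Z w * (hs_ind e c (X j w) *
    hs_kernel e (c - eps) (s + h j) (X j w) y).
  by have /andP[? ?] := Z01 w; rewrite mulr_ge0// hs0.
rewrite -ge0_integralZl_EFin//; last 3 first.
- by move=> w _; rewrite lee_fin.
- exact: measurable_EFin.
- by rewrite addr_ge0.
rewrite -ge0_integralD//; last 4 first.
- by move=> w _; rewrite -EFinM lee_fin mulr_ge0// addr_ge0.
- apply: (@measurable_EFin _ _ _ _ (fun w => (1 + eta) * _)).
  exact: measurable_funM.
- by move=> w _; rewrite lee_fin.
- by apply: measurable_EFin; exact: mhk.
apply: ge0_le_integral => //.
- by move=> w _; rewrite lee_fin addr_ge0// mulr_ge0.
- apply: measurable_EFin; apply: measurable_funD; first exact: mhk.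
  by apply: measurable_funM => //; exact: mhk.
- apply: (@measurable_EFin _ _ _ _ (fun w => (1 + eta) * _ + _)).
  by apply: measurable_funD; [exact: measurable_funM|exact: mhk].
move=> w _; rewrite -EFinM -EFinD lee_fin [leLHS]addrC.
have Z1E v : Z1 w * v = Z w * (hs_ind e c (X j w) * v) by rewrite [RHS]mulrA.
rewrite [K * _]mulrCA [(1 + eta) * _]mulrCA !Z1E -!mulrDr.
have /andP[? ?] := Z01 w; rewrite ler_wpM2l// /hs_ind.
case: ltP => [cX|]; last by rewrite !(mul0r, mulr0, addr0).
rewrite !mul1r /y1 (@heat_kernel_reflect _ _ e (c - eps))//.
have := hs_correction_le e1 s0 h0 hs stau eps0 cy (ltW cX).
rewrite -/b -/th -/K -/y2 => KE.
have q0 : 0 <= hs_kernel e (c - eps) (s + h j) (X j w) y.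
  by rewrite hs_kernel_ge0//; lra.
apply: (@le_trans _ _ (eta * hs_kernel e (c - eps) (s + h j) (X j w) y +
    heat_kernel (s + h j) (X j w) y)).
  by rewrite lerD2r (le_trans KE)// ler_wpM2r.
by rewrite (addrC 1) mulrDl mul1r -addrA lerD2l /hs_kernel -/b -mulrDr subrK mulr1.
Qed.

End hs_walk.

(** * Iteration along the time grid *)

Section hs_chain.
Context (R : realType) (n : nat) d (Omega : measurableType d).
Variables (P : probability Omega R) (g : nat -> Omega -> R) (h : nat -> R)
  (N : nat) (X : nat -> Omega -> 'rV[R]_n).
Hypothesis walk : gaussian_walk P g h N X.
Implicit Types (e y : 'rV[R]_n) (c eps s tau : R).

Definition path_ind e c j0 m w : R := \prod_(l < m) hs_ind e c (X (j0 + l) w).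

Lemma path_ind01 e c j0 m w : 0 <= path_ind e c j0 m w <= 1.
Proof.
apply/andP; split; first by apply: prodr_ge0 => l _; exact: hs_ind_ge0.
by apply: prodr_ile1 => l _; rewrite hs_ind_ge0 hs_ind_le1.
Qed.

Lemma path_indS e c j0 m w :
  path_ind e c j0 m.+1 w = path_ind e c j0 m w * hs_ind e c (X (j0 + m) w).
Proof. by rewrite /path_ind big_ord_recr. Qed.

Lemma past_measurable_path_ind k e c j0 m : ((j0 + m).-1 * n <= k)%N ->
  past_measurable g k (path_ind e c j0 m).
Proof.
move=> jk; apply: measurable_funP_prod => l _.
apply: (past_measurable_hs_ind walk); apply: leq_trans jk.
rewrite leq_mul2r; apply/orP; right; case: m l => [[]//|m] l.
by rewrite addnS/= leq_add2l -ltnS.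
Qed.

(** The induction removes the last step: the earlier indicators belong to its past and join [Z], and
    the kernel time grows by that step, so [hm <= s] persists. The common bound [tau] on the kernel
    times lets one [eta] serve all steps. *)
Lemma integral_hs_chain m j0 (Z : Omega -> R) e c eps hm s tau eta y :
  (j0 + m <= N)%N -> walk_past n g j0 Z -> (forall w, 0 <= Z w <= 1) ->
  dotv e e = 1 -> 0 < eps -> 0 < s -> (forall j, h j <= hm) -> hm <= s ->
  s + \sum_(l < m) h (j0 + l)%N <= tau -> c <= dotv e y ->
  expR (- (eps ^+ 2 / (8 * hm))) / (1 - expR (- (eps ^+ 2 / tau))) <= eta ->
  (\int[P]_w (Z w * path_ind e c j0 m.+1 w *
     hs_kernel e (c - eps) s (X (j0 + m) w) y)%:E <=
   ((1 + eta) ^+ m)%:E * \int[P]_w (Z w * (hs_ind e c (X j0 w) *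
     hs_kernel e (c - eps) (s + \sum_(l < m) h (j0 + l)%N) (X j0 w) y))%:E)%E.
Proof.
move=> j0m mZ Z01 e1 eps0 s0 hhm hms stau cy eta_ge.
elim: m s j0m s0 hms stau => [|m IH] s j0m s0 hms stau.
  rewrite expr0 mul1e big_ord0 !addr0 addn0 le_eqVlt; apply/orP; left; apply/eqP.
  by apply: eq_integral => w _; rewrite /path_ind big_ord1 addn0 mulrA.
have h0 j := walk_h0 walk j.
have sum_ge0 : 0 <= \sum_(l < m) h (j0 + l)%N by apply: sumr_ge0 => l _; rewrite ltW.
have hm0 : 0 < hm by exact: lt_le_trans (h0 0%N) (hhm 0%N).
rewrite big_ord_recr /= in stau *.
have tau0 : 0 < tau by apply: lt_le_trans stau; have := h0 (j0 + m)%N; lra.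
have k0 : 0 < 1 - expR (- (eps ^+ 2 / tau)).
  by rewrite subr_gt0 expR_lt1 oppr_lt0 divr_gt0 ?exprn_gt0.
have eta0 : 0 <= eta by apply: le_trans eta_ge; rewrite divr_ge0 ?expR_ge0// ltW.
have eta_ge' : expR (- (eps ^+ 2 / (8 * h (j0 + m)%N))) /
    (1 - expR (- (eps ^+ 2 / tau))) <= eta.
  apply: le_trans eta_ge; rewrite ler_wpM2r ?invr_ge0 ?(ltW k0)// ler_expR lerN2.
  by rewrite ler_wpM2l ?sqr_ge0// lef_pV2 ?posrE ?mulr_gt0// ler_wpM2l.
pose Z' w := Z w * path_ind e c j0 m w.
have Z'01 w : 0 <= Z' w <= 1.
  have /andP[? ?] := Z01 w; have /andP[? ?] := path_ind01 e c j0 m w.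
  by rewrite mulr_ge0//= -[leRHS]mulr1 ler_pM.
have mZ' : walk_past n g (j0 + m)%N Z'.
  apply: measurable_funM.
    by apply: past_measurableW mZ; rewrite leq_mul2r leq_addr orbT.
  by apply: past_measurable_path_ind; rewrite leq_mul2r leq_pred orbT.
have sh0 : 0 < s + h (j0 + m)%N by rewrite addr_gt0.
have hmsh : hm <= s + h (j0 + m)%N by rewrite (le_trans hms)// lerDl ltW.
have shtau : s + h (j0 + m)%N <= tau by rewrite (le_trans _ stau)//; lra.
have jmN : (j0 + m < N)%N by rewrite -addnS.
have step := integral_hs_step walk jmN mZ' Z'01 e1 eps0 s0
  (le_trans (hhm _) hms) shtau cy eta_ge'.
rewrite (eq_integral (fun w => (Z' w * hs_ind e c (X (j0 + m)%N w) *
     (hs_ind e c (X (j0 + m).+1 w) *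
      hs_kernel e (c - eps) s (X (j0 + m).+1 w) y))%:E)); last first.
  by move=> w _; rewrite 2!path_indS addnS /Z' !mulrA.
apply: (le_trans step); rewrite exprS EFinM -muleA.
apply: lee_wpmul2l; first by rewrite lee_fin addr_ge0.
rewrite (eq_integral (fun w => (Z w * path_ind e c j0 m.+1 w *
     hs_kernel e (c - eps) (s + h (j0 + m)%N) (X (j0 + m)%N w) y)%:E)); last first.
  by move=> w _; rewrite path_indS /Z' !mulrA.
rewrite (addrC (\sum_(l < m) _)) addrA; apply: IH => //; first exact: ltnW.
by rewrite -addrA (addrC (h _)).
Qed.

(** The factor 2 is the passage from the free to the half-space kernel over the last time
    [s <= eps ^ 2]. The mesh condition says [m * eta <= 1], so the step factors multiply to at most
    [expR 1]. *)
Lemma integral_heat_kernel_hs m j0 (Z : Omega -> R) e c eps hm s tau y :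
  (j0 + m <= N)%N -> walk_past n g j0 Z -> (forall w, 0 <= Z w <= 1) ->
  dotv e e = 1 -> 0 < eps -> 0 < s -> (forall j, h j <= hm) -> hm <= s ->
  s <= eps ^+ 2 -> s + \sum_(l < m) h (j0 + l)%N <= tau -> c <= dotv e y ->
  m%:R * (expR (- (eps ^+ 2 / (8 * hm))) / (1 - expR (- (eps ^+ 2 / tau)))) <= 1 ->
  (\int[P]_w (Z w * path_ind e c j0 m.+1 w * heat_kernel s (X (j0 + m) w) y)%:E <=
   (2 * expR 1)%:E * \int[P]_w (Z w * (hs_ind e c (X j0 w) *
     hs_kernel e (c - eps) (s + \sum_(l < m) h (j0 + l)%N) (X j0 w) y))%:E)%E.
Proof.
move=> j0m mZ Z01 e1 eps0 s0 hhm hms seps stau cy eta1.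
set eta := (X in _ * X <= 1) in eta1.
have h0 j := walk_h0 walk j.
have mX W k : past_measurable g k W -> measurable_fun setT W.
  exact: past_measurableT (walk_measurable walk) _ _.
have sum_ge0 : 0 <= \sum_(l < m) h (j0 + l)%N by apply: sumr_ge0 => l _; rewrite ltW.
have mZ1 : measurable_fun setT (fun w => Z w * path_ind e c j0 m.+1 w).
  apply: measurable_funM; first exact: mX mZ.
  exact: mX (past_measurable_path_ind _ _ (leqnn _)).
have hs0 w : 0 <= Z w * path_ind e c j0 m.+1 w *
    hs_kernel e (c - eps) s (X (j0 + m) w) y.
  have /andP[? ?] := Z01 w; have /andP[? ?] := path_ind01 e c j0 m w.
  rewrite path_indS /hs_ind; case: ltP => [cX|_]; last by rewrite !(mulr0, mul0r).
  rewrite mulr1; apply: mulr_ge0; first exact: mulr_ge0.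
  by apply: hs_kernel_ge0 => //; lra.
have mhs : measurable_fun setT (fun w => Z w * path_ind e c j0 m.+1 w *
    hs_kernel e (c - eps) s (X (j0 + m) w) y).
  apply: measurable_funM => //.
  exact: mX (past_measurable_hs_kernel walk _ _ _ s0 (leqnn _)).
apply: (@le_trans _ _ (2%:E * \int[P]_w (Z w * path_ind e c j0 m.+1 w *
     hs_kernel e (c - eps) s (X (j0 + m) w) y)%:E)%E).
  rewrite -ge0_integralZl_EFin//; last 2 first.
  - by move=> w _; rewrite lee_fin.
  - exact: measurable_EFin.
  apply: ge0_le_integral => //.
  - move=> w _; have /andP[? ?] := Z01 w; have /andP[? ?] := path_ind01 e c j0 m.+1 w.
    by rewrite lee_fin mulr_ge0 ?heat_kernel_ge0// mulr_ge0.
  - apply: measurable_EFin; apply: measurable_funM => //.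
    exact: mX (past_measurable_heat_kernel walk _ s0 (leqnn _)).
  - apply: (@measurable_EFin _ _ _ _ (fun w => 2 * _)).
    exact: measurable_funM.
  move=> w _; rewrite -EFinM lee_fin.
  have /andP[? ?] := Z01 w; have /andP[? ?] := path_ind01 e c j0 m w.
  rewrite path_indS /hs_ind; case: ltP => [cX|_]; last by rewrite !(mulr0, mul0r).
  rewrite mulr1 [leRHS]mulrCA; apply: ler_wpM2l; first exact: mulr_ge0.
  by rewrite heat_kernel_le_hs// ltW.
rewrite EFinM -muleA lee_pmul2l ?lte_fin//.
apply: le_trans (integral_hs_chain j0m mZ Z01 e1 eps0 s0 hhm hms stau cy (lexx _)) _.
rewrite lee_pmul ?lee_fin ?exprn_ge0//.
- rewrite addr_ge0// divr_ge0 ?expR_ge0// subr_ge0 -expR0 ler_expR oppr_le0.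
  by rewrite divr_ge0 ?sqr_ge0// (le_trans _ stau)// addr_ge0// ltW.
- apply: integral_ge0 => w _; have /andP[? ?] := Z01 w.
  rewrite lee_fin mulr_ge0// /hs_ind; case: ltP => [cX|_]; last by rewrite mul0r.
  by rewrite mul1r hs_kernel_ge0//; [rewrite ltr_pwDl|lra|lra].
rewrite (@le_trans _ _ (expR eta ^+ m))//.
  rewrite lerXn2r ?nnegrE ?expR_ge0// ?expR_ge1Dx//.
  rewrite addr_ge0// divr_ge0 ?expR_ge0// subr_ge0 -expR0 ler_expR oppr_le0.
  by rewrite divr_ge0 ?sqr_ge0// (le_trans _ stau)// addr_ge0// ltW.
by rewrite -expRM_natl ler_expR.
Qed.

Lemma integral_heat_kernel_start m e c eps hm s tau x y :
  (forall w, X 0%N w = x) -> (m <= N)%N ->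
  dotv e e = 1 -> 0 < eps -> 0 < s -> (forall j, h j <= hm) -> hm <= s ->
  s <= eps ^+ 2 -> s + \sum_(l < m) h l <= tau -> c < dotv e x -> c <= dotv e y ->
  m%:R * (expR (- (eps ^+ 2 / (8 * hm))) / (1 - expR (- (eps ^+ 2 / tau)))) <= 1 ->
  (\int[P]_w (path_ind e c 0 m.+1 w * heat_kernel s (X m w) y)%:E <=
   (2 * expR 1 * hs_kernel e (c - eps) (s + \sum_(l < m) h l) x y)%:E)%E.
Proof.
move=> X0 mN e1 eps0 s0 hhm hms seps stau cx cy mesh.
have m1 : walk_past n g 0 (fun=> 1) by exact: measurable_cst.
have Z01 (w : Omega) : 0 <= (1 : R) <= 1 by rewrite ler01 lexx.
have hE : \sum_(l < m) h (0 + l)%N = \sum_(l < m) h l by [].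
have := integral_heat_kernel_hs (mN : (0 + m <= N)%N) m1 Z01 e1 eps0 s0 hhm hms
  seps (stau : s + \sum_(l < m) h (0 + l)%N <= tau) cy mesh.
under eq_integral do rewrite mul1r add0n.
move=> /le_trans; apply; rewrite [leRHS]EFinM lee_pmul2l ?lte_fin ?mulr_gt0 ?expR_gt0//.
under eq_integral do rewrite mul1r X0.
rewrite integral_cst//= (@probability_setT _ _ _ P) mule1 lee_fin.
by rewrite /hs_ind cx mul1r hE.
Qed.

End hs_chain.

(** * Iterated Lebesgue integrals *)

Lemma le_integralT d (T : measurableType d) (R : realType)
    (mu : {measure set T -> \bar R}) (f1 f2 : T -> \bar R) :
  (forall x, 0 <= f1 x)%E -> (forall x, f1 x <= f2 x)%E ->
  (\int[mu]_x f1 x <= \int[mu]_x f2 x)%E.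
Proof.
move=> f10 f12; have f20 x : (0 <= f2 x)%E by exact: le_trans (f12 x).
rewrite !ge0_integralTE//; apply: ereal_sup_le => _ [h /= hf <-].
by exists h => //= x; exact: le_trans (hf x) (f12 x).
Qed.

Section lebesgue_int.
Context {R : realType}.

Lemma lebesgue_int_ge0 n (f : 'rV[R]_n -> \bar R) :
  (forall x, 0 <= f x)%E -> (0 <= lebesgue_int f)%E.
Proof. by elim: n f => [|n IH] f f0 //=; apply: integral_ge0 => s _; exact: IH. Qed.

Lemma lebesgue_int_le n (f1 f2 : 'rV[R]_n -> \bar R) :
  (forall x, 0 <= f1 x)%E -> (forall x, f1 x <= f2 x)%E ->
  (lebesgue_int f1 <= lebesgue_int f2)%E.
Proof.
elim: n f1 f2 => [|n IH] f1 f2 f10 f12 //=.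
by apply: le_integralT => s; [exact: lebesgue_int_ge0|exact: IH].
Qed.

Lemma eq_lebesgue_int n (f1 f2 : 'rV[R]_n -> \bar R) :
  f1 =1 f2 -> lebesgue_int f1 = lebesgue_int f2.
Proof. by move=> /funext ->. Qed.

Lemma row_mx0 n s (v : 'rV[R]_n) :
  (row_mx (const_mx s : 'rV[R]_1) v : 'rV[R]_n.+1) 0 ord0 = s.
Proof.
rewrite (_ : ord0 = lshift n (ord0 : 'I_1)); last exact/val_inj.
by rewrite (row_mxEl (const_mx s : 'rV[R]_1) v) mxE.
Qed.

Lemma row_mxS n s (v : 'rV[R]_n) i :
  (row_mx (const_mx s : 'rV[R]_1) v : 'rV[R]_n.+1) 0 (lift ord0 i) = v 0 i.
Proof.
rewrite (_ : lift ord0 i = rshift 1 i); last exact/val_inj.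
by rewrite (row_mxEr (const_mx s : 'rV[R]_1) v).
Qed.

(** Two products are carried together through the induction, so that additivity is used only for the
    explicit integrands in the first coordinate. Two are wanted for the opposite tilts in
    [two_phase]. *)
Lemma lebesgue_int_prodD n (a b : R) (f1 f2 : 'I_n -> R -> R) (I1 I2 : 'I_n -> R) :
  0 <= a -> 0 <= b ->
  (forall i x, 0 <= f1 i x) -> (forall i x, 0 <= f2 i x) ->
  (forall i, measurable_fun setT (f1 i)) -> (forall i, measurable_fun setT (f2 i)) ->
  (forall i, \int[lebesgue_measure]_x (f1 i x)%:E = (I1 i)%:E)%E ->
  (forall i, \int[lebesgue_measure]_x (f2 i x)%:E = (I2 i)%:E)%E ->
  lebesgue_int (fun v : 'rV[R]_n =>
    (a * \prod_(i < n) f1 i (v 0 i) + b * \prod_(i < n) f2 i (v 0 i))%:E) =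
  (a * \prod_(i < n) I1 i + b * \prod_(i < n) I2 i)%:E.
Proof.
elim: n a b f1 f2 I1 I2 => [|n IH] a b f1 f2 I1 I2 a0 b0 f10 f20 mf1 mf2 fI1 fI2.
  by rewrite /= !big_ord0.
rewrite /=; have I0 (f : 'I_n.+1 -> R -> R) (I : 'I_n.+1 -> R) i :
    (forall i x, 0 <= f i x) ->
    (forall i, \int[lebesgue_measure]_x (f i x)%:E = (I i)%:E)%E -> 0 <= I i.
  by move=> f0 fI; rewrite -lee_fin -fI; apply: integral_ge0 => x _; rewrite lee_fin.
pose J1 := \prod_(i < n) I1 (lift ord0 i).
pose J2 := \prod_(i < n) I2 (lift ord0 i).
have J10 : 0 <= J1 by apply: prodr_ge0 => i _; exact: I0 fI1.
have J20 : 0 <= J2 by apply: prodr_ge0 => i _; exact: I0 fI2.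
have zE c (f : R -> R) I : 0 <= c -> (forall x, 0 <= f x) ->
    measurable_fun setT f -> (\int[lebesgue_measure]_x (f x)%:E = I%:E)%E ->
    (\int[lebesgue_measure]_x (c%:E * (f x)%:E) = (c * I)%:E)%E.
  move=> c0 f0 mf fI; rewrite ge0_integralZl_EFin//.
  - by rewrite fI EFinM.
  - by move=> x _; rewrite lee_fin.
  - exact: measurable_EFin.
transitivity (\int[lebesgue_measure]_s
    ((a * J1)%:E * (f1 ord0 s)%:E + (b * J2)%:E * (f2 ord0 s)%:E))%E.
  apply: eq_integral => s _.
  rewrite -!EFinM -EFinD mulrAC [X in _ + X]mulrAC /J1 /J2.
  rewrite -(IH _ _ (fun i => f1 (lift ord0 i)) (fun i => f2 (lift ord0 i)))//; last 2 first.
  - exact: mulr_ge0.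
  - exact: mulr_ge0.
  apply: eq_lebesgue_int => v; rewrite !big_ord_recl !row_mx0 !mulrA.
  by congr (_ * _ + _ * _)%:E; apply: eq_bigr => i _; rewrite row_mxS.
rewrite ge0_integralD//.
- rewrite (zE _ _ (I1 ord0)) ?mulr_ge0// (zE _ _ (I2 ord0)) ?mulr_ge0//.
  by rewrite !big_ord_recl /J1 /J2 -EFinD; congr EFin; ring.
- by move=> x _; rewrite -EFinM lee_fin !mulr_ge0.
- apply: (@measurable_EFin _ _ _ _ (fun s => a * J1 * f1 ord0 s)).
  by apply: measurable_funM.
- by move=> x _; rewrite -EFinM lee_fin !mulr_ge0.
- apply: (@measurable_EFin _ _ _ _ (fun s => b * J2 * f2 ord0 s)).
  by apply: measurable_funM.
Qed.

Lemma lebesgue_int_heat_kernelD n (a b s t : R) (x y1 y2 : 'rV[R]_n) :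
  0 <= a -> 0 <= b -> 0 < s -> 0 < t ->
  lebesgue_int (fun v => (a * (heat_kernel s x v * heat_kernel t v y1) +
    b * (heat_kernel s x v * heat_kernel t v y2))%:E) =
  (a * heat_kernel (s + t) x y1 + b * heat_kernel (s + t) x y2)%:E.
Proof.
move=> a0 b0 s0 t0; have st0 := addr_gt0 s0 t0.
have mf (y : 'rV[R]_n) i : measurable_fun setT (fun r => gauss1 s (x 0 i) r * gauss1 t r (y 0 i)).
  apply: measurable_funM; last exact: measurable_gauss1l.
  rewrite (_ : gauss1 s _ = gauss1 s ^~ (x 0 i)); first exact: measurable_gauss1l.
  by apply/funext => r; rewrite gauss1C.
have f0 (y : 'rV[R]_n) i r : 0 <= gauss1 s (x 0 i) r * gauss1 t r (y 0 i).
  by rewrite mulr_ge0// gauss1_ge0.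
have fI (y : 'rV[R]_n) i := integral_gauss1M (x 0 i) (y 0 i) s0 t0.
have := lebesgue_int_prodD a0 b0 (f0 y1) (f0 y2) (mf y1) (mf y2) (fI y1) (fI y2).
rewrite !heat_kernel_prod// => <-; apply: eq_lebesgue_int => v.
by rewrite !heat_kernel_prod// !big_split.
Qed.

End lebesgue_int.

(** * Inserting an intermediate point *)

Section mixture.
Context (R : realType) d (Omega : measurableType d) (P : probability Omega R).

Lemma measurable_gauss1_pair d' (T : measurableType d') s (f g : T -> R) : 0 < s ->
  measurable_fun setT f -> measurable_fun setT g ->
  measurable_fun setT (fun z => gauss1 s (f z) (g z)).
Proof.
move=> s0 mf mg.
rewrite (_ : (fun z => _) = fun z => gauss1 s (f z - g z) 0).
  apply: (measurableT_comp (measurable_gauss1l s 0)).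
  exact: measurable_funB.
by apply/funext => z; rewrite !gauss1E// subr0.
Qed.

(** Tonelli in the first coordinate; its pair of Gaussians then joins [Z], and the induction treats
    the other coordinates. *)
Lemma integral_prod_gauss1_mix n (Z : Omega -> R) (Y : 'I_n -> Omega -> R)
    (y : 'I_n -> R) s t : 0 < s -> 0 < t ->
  measurable_fun setT Z -> (forall w, 0 <= Z w) ->
  (forall i, measurable_fun setT (Y i)) ->
  (\int[P]_w (Z w * \prod_(i < n) gauss1 (s + t) (Y i w) (y i))%:E =
   lebesgue_int (fun v : 'rV[R]_n => \int[P]_w
     (Z w * \prod_(i < n) (gauss1 s (Y i w) (v 0 i) * gauss1 t (v 0 i) (y i)))%:E))%E.
Proof.
move=> s0 t0; elim: n Z Y y => [|n IH] Z Y y mZ Z0 mY.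
  by rewrite /=; apply: eq_integral => w _; rewrite !big_ord0.
rewrite /=; have g0 := @gauss1_ge0 R.
pose Pr w := \prod_(i < n) gauss1 (s + t) (Y (lift ord0 i) w) (y (lift ord0 i)).
have Pr0 w : 0 <= Pr w by apply: prodr_ge0 => i _; exact: g0.
have mPr : measurable_fun setT Pr.
  apply: measurable_funP_prod => i _.
  exact: (measurableT_comp (measurable_gauss1l _ _) (mY _)).
pose F (z : Omega * measurableTypeR R) := (Z z.1 * Pr z.1 *
  (gauss1 s (Y ord0 z.1) z.2 * gauss1 t z.2 (y ord0)))%:E.
have m1 : measurable_fun [set: Omega * measurableTypeR R] fst by exact: measurable_fst.
have m2 : measurable_fun [set: Omega * measurableTypeR R] (snd : _ -> R).
  exact: measurable_snd.
have mF : measurable_fun setT F.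
  apply: measurable_EFin; apply: measurable_funM.
    apply: measurable_funM; first exact: (measurableT_comp mZ m1).
    exact: (measurableT_comp mPr m1).
  apply: measurable_funM.
    exact: (measurable_gauss1_pair s0 (measurableT_comp (mY ord0) m1) m2).
  exact: (measurableT_comp (measurable_gauss1l _ _) m2).
have F0 z : (0 <= F z)%E by rewrite lee_fin !mulr_ge0.
have mgg w : measurable_fun setT (fun r : R => gauss1 s (Y ord0 w) r * gauss1 t r (y ord0)).
  apply: measurable_funM; last exact: (measurable_gauss1l t (y ord0)).
  rewrite (_ : gauss1 s _ = (gauss1 s)^~ (Y ord0 w)); first exact: measurable_gauss1l.
  by apply/funext => r; rewrite gauss1C.
transitivity (\int[P]_w \int[lebesgue_measure]_r F (w, r))%E.
  apply: eq_integral => w _; rewrite /F /=.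
  under [RHS]eq_integral do rewrite EFinM.
  rewrite ge0_integralZl_EFin ?mulr_ge0//.
  - by rewrite integral_gauss1M// -EFinM big_ord_recl -/(Pr w) (mulrC (gauss1 _ _ _)) mulrA.
  - by move=> r _; rewrite lee_fin mulr_ge0.
  - apply: measurable_EFin; exact: mgg.
rewrite (fubini_tonelli F mF F0); apply: eq_integral => r _.
pose Zr w := Z w * (gauss1 s (Y ord0 w) r * gauss1 t r (y ord0)).
have mZr : measurable_fun setT Zr.
  apply: measurable_funM => //; apply: measurable_funM => //.
  exact: (measurableT_comp (measurable_gauss1l _ _) (mY _)).
have Zr0 w : 0 <= Zr w by rewrite mulr_ge0// mulr_ge0.
transitivity (\int[P]_w (Zr w * Pr w)%:E)%E.
  by apply: eq_integral => w _; rewrite /F /Zr /= mulrAC.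
rewrite IH//; apply: eq_lebesgue_int => v; apply: eq_integral => w _.
rewrite big_ord_recl !row_mx0 /Zr; congr EFin; rewrite -[LHS]mulrA; congr (_ * (_ * _)).
by apply: eq_bigr => i _; rewrite row_mxS.
Qed.

(** After the intermediate point [v] is inserted, the first phase enters only through a function of
    [v], which can be bounded pointwise. *)
Lemma integral_heat_kernel_mix n (Z : Omega -> R) (Y : Omega -> 'rV[R]_n) y s t :
  0 < s -> 0 < t -> measurable_fun setT Z -> (forall w, 0 <= Z w) ->
  (forall i, measurable_fun setT (fun w => Y w 0 i)) ->
  (\int[P]_w (Z w * heat_kernel (s + t) (Y w) y)%:E =
   lebesgue_int (fun v : 'rV[R]_n =>
     (\int[P]_w (Z w * heat_kernel s (Y w) v)%:E * (heat_kernel t v y)%:E)%E))%E.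
Proof.
move=> s0 t0 mZ Z0 mY; have st0 := addr_gt0 s0 t0.
transitivity (\int[P]_w (Z w * \prod_(i < n) gauss1 (s + t) (Y w 0 i) (y 0 i))%:E)%E.
  by apply: eq_integral => w _; rewrite heat_kernel_prod.
rewrite (@integral_prod_gauss1_mix n Z (fun i w => Y w 0 i) (fun i => y 0 i))//.
apply: eq_lebesgue_int => v.
rewrite muleC -ge0_integralZl_EFin ?heat_kernel_ge0//.
- apply: eq_integral => w _; rewrite -EFinM mulrCA !heat_kernel_prod// big_split/=.
  by rewrite [X in (_ * X)%:E]mulrC.
- by move=> w _; rewrite lee_fin mulr_ge0// heat_kernel_ge0.
- apply: measurable_EFin; apply: measurable_funM => //.
  rewrite (_ : (fun w => _) = fun w => \prod_(i < n) gauss1 s (Y w 0 i) (v 0 i)); last first.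
    by apply/funext => w; rewrite heat_kernel_prod.
  apply: measurable_funP_prod => i _.
  exact: (measurableT_comp (measurable_gauss1l _ _) (mY _)).
Qed.

End mixture.

(** * Two half-spaces *)

Section two_phase_pointwise.
Context {R : realType} {n : nat}.
Implicit Types (s t c eps rho k : R) (x y z v e : 'rV[R]_n).

Lemma ler_mul_expR rho u : 0 < rho -> u <= rho * expR (u / rho).
Proof.
move=> rho0; rewrite -ler_pdivrMl// mulrC.
by apply: le_trans (expR_ge1Dx _); rewrite lerDr.
Qed.

Lemma heat_kernel_expR e c s th z y : dotv e e = 1 -> 0 < s ->
  heat_kernel s z y * expR (th * (dotv e z - c)) =
  expR (th * (dotv e y - c) + s * th ^+ 2) * heat_kernel s z (y + (2 * s * th) *: e).
Proof.
move=> e1 s0; rewrite heat_kernel_shift// mulrCA -expRD; congr (_ * expR _).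
by rewrite !dotvE e1; field; rewrite gt_eqF.
Qed.

(** The kernel is at most linear in the distance of [z]; [ler_mul_expR] turns this into an
    exponential, which is absorbed by moving [y]. The 2 comes from [eps <= dotv e y - c]. *)
Lemma hs_kernel_le_shift e c eps s rho z y : dotv e e = 1 -> 0 < s -> 0 < rho ->
  0 < eps -> eps <= dotv e y - c ->
  hs_ind e c z * hs_kernel e (c - eps) s z y <=
  2 * (dotv e y - c) / s * rho *
    expR (rho^-1 * (dotv e y - (c - eps)) + s * rho^-1 ^+ 2) *
    heat_kernel s z (y + (2 * s * rho^-1) *: e).
Proof.
move=> e1 s0 rho0 eps0 yeps; rewrite -mulrA -heat_kernel_expR//.
have d0 : 0 <= dotv e y - c by lra.
rewrite /hs_ind; case: ltP => [cz|_]; last first.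
  rewrite mul0r; apply: mulr_ge0; last by rewrite mulr_ge0 ?heat_kernel_ge0 ?expR_ge0.
  by rewrite mulr_ge0 ?(ltW rho0)// divr_ge0 ?(ltW s0)// mulr_ge0.
rewrite mul1r (le_trans (hs_kernel_le _ _ _ _ _))//.
rewrite [leRHS]mulrCA ler_wpM2l ?heat_kernel_ge0//.
set D := dotv e z - (c - eps); set b := dotv e y - (c - eps).
have -> : D * b / s = b / s * D by ring.
have h1 : D <= rho * expR (rho^-1 * D) by rewrite [_^-1 * _]mulrC; exact: ler_mul_expR.
rewrite -[leRHS]mulrA ler_pM//.
- by rewrite divr_ge0 ?ltW// /b; lra.
- by rewrite /D; lra.
- by rewrite ler_wpM2r ?invr_ge0 ?(ltW s0)// /b; lra.
Qed.

(** Merges the two factors of the bound in [phase1] into one exponential of rate [(1 + L) / rho]: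
    the linear factor contributes 1 and the exponential one [L], while the shift by [eps <= rho]
    costs [expR (1 + L)]. *)
Lemma mul_expR_le rho k L eps D : 0 < rho -> 0 <= k -> k * rho <= L -> 0 <= eps ->
  eps <= rho -> 0 <= D ->
  k * (D + eps) * expR (k * (D + eps)) <=
  k * rho * expR (1 + L) * expR ((1 + L) * D / rho).
Proof.
move=> rho0 k0 kL eps0 eps_rho D0; set u := D + eps.
have u0 : 0 <= u by rewrite addr_ge0.
have h1 : k * u <= k * rho * expR (u / rho).
  by rewrite -mulrA ler_wpM2l// ler_mul_expR.
have h2 : k * u <= L * (u / rho).
  rewrite mulrA ler_pdivlMr// -mulrA [u * _]mulrC mulrA ler_wpM2r//.
have L0 : 0 <= 1 + L by rewrite addr_ge0// (le_trans _ kL)// mulr_ge0// ltW.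
rewrite -[leRHS]mulrA -expRD.
apply: (@le_trans _ _ (k * rho * expR (u / rho) * expR (L * (u / rho)))).
  by rewrite ler_pM ?expR_ge0 ?mulr_ge0// ler_expR.
rewrite -mulrA -expRD ler_wpM2l ?mulr_ge0 ?(ltW rho0)// ler_expR.
have -> : u / rho + L * (u / rho) = (1 + L) * (D / rho) + (1 + L) * (eps / rho).
  by rewrite /u; field; rewrite gt_eqF.
rewrite addrC mulrA lerD2r -[leRHS]mulr1 ler_wpM2l//.
by rewrite ler_pdivrMr// mul1r.
Qed.

Lemma expR_norm_le (a : R) : expR `|a| <= expR a + expR (- a).
Proof.
have := expR_ge0 a; have := expR_ge0 (- a).
by move=> ? ?; case: ger0P => _; lra.
Qed.

End two_phase_pointwise.

Section exponent.
Context {R : realType}.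

(* The exponent collected by the two tilts, [p] and [q] standing for [1 / rho'] and [+- L / rho]. *)
Lemma two_tilt_exponent_le (s0 t1 sg al ga dx dy eps rho rho' ee p q L : R) :
  0 < s0 -> 0 < t1 -> 0 < sg -> sg <= s0 -> sg <= t1 -> 0 < dx -> 0 < dy ->
  0 < al -> 0 < ga -> 0 < eps -> 0 < rho -> 0 < rho' -> eps <= rho' -> 0 <= L ->
  (s0 * dx + t1 * al) / (s0 + t1) <= rho ->
  (t1 * dy + s0 * ga) / (s0 + t1) <= rho' ->
  s0 * t1 / (s0 + t1) <= rho ^+ 2 -> s0 * t1 / (s0 + t1) <= rho' ^+ 2 ->
  p = rho'^-1 -> `|q| = L / rho -> `|ee| <= 1 ->
  p * (dy + eps) + (s0 + sg) * p ^+ 2 +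
    (q * (al + 2 * (s0 + sg) * p * ee) + s0 * q ^+ 2) +
  (((s0 + sg) * p * (ga - dy) + s0 * q * (dx - al)) / (s0 + t1 + sg) -
   ((s0 + sg) ^+ 2 * p ^+ 2 + 2 * (s0 + sg) * s0 * p * q * ee + s0 ^+ 2 * q ^+ 2) /
     (s0 + t1 + sg)) <=
  5 + 10 * L + 2 * L ^+ 2.
Proof.
move=> s00 t10 sg0 sgs sgt dx0 dy0 al0 ga0 eps0 rho0 rho'0 epsr L0 r1 r1' r2 r2' pE qE ee1.
set S := s0 + t1 in r1 r1' r2 r2' *.
have S0 : 0 < S by rewrite addr_gt0.
have t'0 : 0 < S + sg by rewrite addr_gt0.
have p0 : 0 < p by rewrite pE invr_gt0.
have leS k a b : 0 <= a -> a <= k * b -> a / (S + sg) <= k * (b / S).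
  move=> a0 ab; apply: (@le_trans _ _ (a / S)).
    by rewrite ler_wpM2l// lef_pV2// lerDl ltW.
  by rewrite mulrA ler_wpM2r// invr_ge0 ltW.
(* Regrouped into means of the two distances under the bridge, variances, and a cross term. As [sg]
   is at most [s0] and [t1], each quotient is at most 2, or 4 in the cross term, times its value at
   [sg = 0]. The six summands are then bounded by 2, 1, [2 * L], 2, [2 * L ^ 2] and [8 * L]. *)
have -> : p * (dy + eps) + (s0 + sg) * p ^+ 2 +
    (q * (al + 2 * (s0 + sg) * p * ee) + s0 * q ^+ 2) +
  (((s0 + sg) * p * (ga - dy) + s0 * q * (dx - al)) / (S + sg) -
   ((s0 + sg) ^+ 2 * p ^+ 2 + 2 * (s0 + sg) * s0 * p * q * ee + s0 ^+ 2 * q ^+ 2) /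
     (S + sg)) =
  p * ((t1 * dy + (s0 + sg) * ga) / (S + sg)) + p * eps +
  q * ((s0 * dx + (t1 + sg) * al) / (S + sg)) +
  p ^+ 2 * ((s0 + sg) * t1 / (S + sg)) +
  q ^+ 2 * (s0 * (t1 + sg) / (S + sg)) +
  2 * (p * (q * ee)) * ((s0 + sg) * (t1 + sg) / (S + sg)).
  by rewrite /S; field; rewrite gt_eqF// -/S.
have h1 : p * ((t1 * dy + (s0 + sg) * ga) / (S + sg)) <= 2.
  rewrite pE ler_pdivrMl// [leRHS]mulrC.
  apply: (@le_trans _ _ (2 * ((t1 * dy + s0 * ga) / S))); last by rewrite ler_pM2l.
  by apply: leS; nra.
have h2 : p * eps <= 1 by rewrite pE ler_pdivrMl// mulr1.
have h3 : q * ((s0 * dx + (t1 + sg) * al) / (S + sg)) <= 2 * L.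
  apply: (@le_trans _ _ (`|q| * (2 * rho))); last first.
    by rewrite qE le_eqVlt; apply/orP; left; apply/eqP; field; rewrite gt_eqF.
  apply: (@le_trans _ _ (`|q| * ((s0 * dx + (t1 + sg) * al) / (S + sg)))).
    rewrite ler_wpM2r ?ler_norm// divr_ge0 ?(ltW t'0)//.
    by rewrite addr_ge0 ?mulr_ge0 ?addr_ge0 ?ltW.
  rewrite ler_wpM2l//.
  apply: (@le_trans _ _ (2 * ((s0 * dx + t1 * al) / S))); last by rewrite ler_pM2l.
  by apply: leS; nra.
have m0 : 0 <= s0 * t1 / S by rewrite divr_ge0 ?mulr_ge0 ?ltW.
have h4 : p ^+ 2 * ((s0 + sg) * t1 / (S + sg)) <= 2.
  rewrite pE exprVn ler_pdivrMl ?exprn_gt0//.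
  apply: (@le_trans _ _ (2 * (s0 * t1 / S))); last by rewrite mulrC ler_wpM2r.
  by apply: leS; nra.
have q2 : q ^+ 2 = L ^+ 2 / rho ^+ 2 by rewrite -[LHS]real_normK ?num_real// qE expr_div_n.
have h5 : q ^+ 2 * (s0 * (t1 + sg) / (S + sg)) <= 2 * L ^+ 2.
  rewrite q2 -mulrA [2 * _]mulrC ler_wpM2l ?sqr_ge0// ler_pdivrMl ?exprn_gt0//.
  apply: (@le_trans _ _ (2 * (s0 * t1 / S))); last by rewrite mulrC ler_wpM2r.
  by apply: leS; nra.
have mrr : s0 * t1 / S <= rho * rho'.
  have rr0 : 0 <= rho * rho' by rewrite mulr_ge0 ?ltW.
  by rewrite -ler_sqr ?nnegrE// expr2 exprMn ler_pM.
have h6 : 2 * (p * (q * ee)) * ((s0 + sg) * (t1 + sg) / (S + sg)) <= 8 * L.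
  apply: (@le_trans _ _ (2 * (p * `|q|) * (4 * (rho * rho')))); last first.
    by rewrite qE pE le_eqVlt; apply/orP; left; apply/eqP; field; rewrite !gt_eqF.
  have qee : q * ee <= `|q|.
    by rewrite (le_trans (ler_norm _))// normrM -[leRHS]mulr1 ler_wpM2l.
  apply: (@le_trans _ _ (2 * (p * `|q|) * ((s0 + sg) * (t1 + sg) / (S + sg)))).
    rewrite ler_wpM2r//; first by rewrite divr_ge0 ?mulr_ge0 ?addr_ge0 ?ltW.
    by rewrite ler_pM2l// ler_pM2l.
  apply: ler_wpM2l; first by rewrite mulr_ge0// mulr_ge0// ltW.
  apply: (@le_trans _ _ (4 * (s0 * t1 / S))); last by rewrite ler_pM2l.
  by apply: leS; nra.
lra.
Qed.

End exponent.

(** * A path kept in one half-space, then in another *)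

Section two_phase.
Context (R : realType) (n : nat) d (Omega : measurableType d).
Implicit Types (P : probability Omega R) (g : nat -> Omega -> R) (h : nat -> R)
  (M : nat) (X : nat -> Omega -> 'rV[R]_n).
Implicit Types (x v e : 'rV[R]_n) (c t s eps sg hm : R).

(** [M] steps of total duration [t1] precede [M] steps of total duration [s0]. The extra time [sg]
    belongs to the final Gaussian that stands for a point mass at [y]. *)
Record phases P g h M X x (t1 s0 : R) eps sg hm : Prop := Phases {
  ph_walk : gaussian_walk P g h (M + M) X ;
  ph_start : forall w, X 0%N w = x ;
  ph_t1 : \sum_(l < M) h l = t1 ;
  ph_s0 : \sum_(l < M) h (M + l)%N = s0 ;
  ph_t1_gt0 : 0 < t1 ;
  ph_s0_gt0 : 0 < s0 ;
  ph_eps : 0 < eps ;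
  ph_sg : 0 < sg ;
  ph_sg_eps : sg <= eps ^+ 2 ;
  ph_hm : forall j, h j <= hm ;
  ph_hm_sg : hm <= sg ;
  ph_mesh : M%:R * (expR (- (eps ^+ 2 / (8 * hm))) /
    (1 - expR (- (eps ^+ 2 / (s0 + t1 + sg))))) <= 1 }.

Lemma measurable_path_heat_kernel P g h N X M e c s j v :
  gaussian_walk P g h N X -> 0 < s ->
  measurable_fun setT (fun w => path_ind X e c 0 M.+1 w * heat_kernel s (X j w) v).
Proof.
move=> walk s0; apply: measurable_funM.
  apply: (past_measurableT (walk_measurable walk)).
  exact: (past_measurable_path_ind walk _ _ (leqnn _)).
apply: (past_measurableT (walk_measurable walk)).
exact: (past_measurable_heat_kernel walk _ s0 (leqnn _)).
Qed.

Lemma phase1_inside P g h M X x (t1 s0 : R) eps sg hm e c v :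
  phases P g h M X x t1 s0 eps sg hm ->
  dotv e e = 1 -> eps <= dotv e x - c -> c <= dotv e v ->
  (\int[P]_w (path_ind X e c 0 M.+1 w * heat_kernel sg (X M w) v)%:E <=
   (2 * expR 1 * (heat_kernel (t1 + sg) x v *
     (2 * (dotv e x - c) / (t1 + sg) * ((dotv e v - c) + eps))))%:E)%E.
Proof.
case=> walk X0 t1E s0E t10 s00 eps0 sg0 sg_eps h_hm hm_sg Meta.
move=> e1 xeps cv; have ts0 : 0 < t1 + sg by rewrite addr_gt0.
have tau_ge : sg + \sum_(l < M) h l <= s0 + t1 + sg by rewrite t1E; lra.
have cx : c < dotv e x by rewrite -subr_gt0 (lt_le_trans eps0).
have := integral_heat_kernel_start walk X0 (leq_addr _ _) e1 eps0 sg0 h_hm hm_sg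
  sg_eps tau_ge cx cv Meta.
move=> /le_trans; apply; rewrite t1E (addrC sg) lee_fin ler_pM2l ?mulr_gt0 ?expR_gt0//.
rewrite (le_trans (hs_kernel_le _ _ _ _ _))// ler_wpM2l ?heat_kernel_ge0//.
rewrite [leRHS]mulrAC ler_wpM2r ?invr_ge0 ?(ltW ts0)//.
by apply: ler_pM; lra.
Qed.

(** The point [v] is reached after a free time [sg], so it may lie outside the half-space. It is
    then replaced by its mirror image, which is closer to every point of the half-space; returning
    to [v] in the kernel from [x] produces the exponential factor. *)
Lemma phase1 P g h M X x (t1 s0 : R) eps sg hm e c v (k := 2 * (dotv e x - c) / (t1 + sg)) :
  phases P g h M X x t1 s0 eps sg hm ->
  dotv e e = 1 -> eps <= dotv e x - c ->
  (\int[P]_w (path_ind X e c 0 M.+1 w * heat_kernel sg (X M w) v)%:E <=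
   (2 * expR 1 * (heat_kernel (t1 + sg) x v *
     (k * (`|dotv e v - c| + eps) * expR (k * (`|dotv e v - c| + eps)))))%:E)%E.
Proof.
move=> ph; case: (ph) => walk X0 t1E s0E t10 s00 eps0 sg0 sg_eps h_hm hm_sg Meta.
move=> e1 xeps; have ts0 : 0 < t1 + sg by rewrite addr_gt0.
have k0 : 0 <= k by rewrite divr_ge0 ?(ltW ts0)// mulr_ge0//; lra.
have C0 : 0 < 2 * expR 1 :> R by rewrite mulr_gt0// expR_gt0.
have [cv|cv] := leP c (dotv e v).
  apply: (le_trans (phase1_inside ph e1 xeps cv)); rewrite lee_fin ler_pM2l//.
  rewrite ler_wpM2l ?heat_kernel_ge0// ger0_norm ?subr_ge0// -/k ler_peMr//.
    by rewrite mulr_ge0//; lra.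
  by rewrite -expR0 ler_expR mulr_ge0//; lra.
pose u := v - (2 * (dotv e v - c)) *: e.
have uE : dotv e u - c = `|dotv e v - c|.
  by rewrite ltr0_norm ?subr_lt0// /u !dotvE e1; ring.
have cu : c <= dotv e u by rewrite -subr_ge0 uE.
apply: (@le_trans _ _ (\int[P]_w (path_ind X e c 0 M.+1 w * heat_kernel sg (X M w) u)%:E)%E).
  apply: ge0_le_integral => //.
  - move=> w _; have /andP[? ?] := path_ind01 X e c 0 M.+1 w.
    by rewrite lee_fin mulr_ge0 ?heat_kernel_ge0.
  - by apply: measurable_EFin; exact: (measurable_path_heat_kernel _ _ _ _ _ walk).
  - by apply: measurable_EFin; exact: (measurable_path_heat_kernel _ _ _ _ _ walk).
  move=> w _; rewrite lee_fin path_indS add0n.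
  have /andP[? ?] := path_ind01 X e c 0 M w.
  rewrite /hs_ind; case: ltP => cX; last by rewrite !(mulr0, mul0r).
  rewrite mulr1 ler_wpM2l// heat_kernel_reflect// ler_peMr ?heat_kernel_ge0//.
  rewrite -expR0 ler_expR -mulNr divr_ge0 ?(ltW sg0)//; nra.
apply: (le_trans (phase1_inside ph e1 xeps cu)); rewrite lee_fin ler_pM2l//.
rewrite uE -/k heat_kernel_reflect// -mulrA ler_wpM2l ?heat_kernel_ge0//.
rewrite mulrC ler_wpM2l//; first by rewrite mulr_ge0// addr_ge0// ltW.
rewrite ler_expR ltr0_norm ?subr_lt0// -mulNr /k mulrAC ler_wpM2r ?invr_ge0 ?(ltW ts0)//.
nra.
Qed.

(** One [2 * expR 1] for each phase. The 8 collects a 2 for each distance enlarged by [eps] and a 2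
    for the two opposite tilts. [expR 7] is from [mul_expR_le] with [L = 6], and 173 is
    [5 + 10 * L + 2 * L ^ 2] at [L = 7]. *)
Definition two_phase_cst : R :=
  (2 * expR 1) * (2 * expR 1) * 8 * expR 7 * expR 173.

Lemma two_phase_cst_gt0 : 0 < two_phase_cst.
Proof. by rewrite /two_phase_cst !mulr_gt0 ?expR_gt0. Qed.

(** [rho] and [rho'] dominate the mean and the fluctuation, under the bridge at time [t1], of the
    distances to the two hyperplanes. The conclusion is the product of the two half-space factors
    with these sizes in place of the random distances. *)
Lemma two_phase P g h M X x (t1 s0 : R) eps sg hm e e' c c' y rho rho' :
  phases P g h M X x t1 s0 eps sg hm ->
  dotv e e = 1 -> dotv e' e' = 1 ->
  eps <= dotv e x - c -> eps <= dotv e' y - c' ->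
  0 < dotv e y - c -> 0 < dotv e' x - c' ->
  0 < rho -> 0 < rho' -> eps <= rho -> eps <= rho' -> sg <= s0 -> sg <= t1 ->
  (s0 * (dotv e x - c) + t1 * (dotv e y - c)) / (s0 + t1) <= rho ->
  (t1 * (dotv e' y - c') + s0 * (dotv e' x - c')) / (s0 + t1) <= rho' ->
  s0 * t1 / (s0 + t1) <= rho ^+ 2 -> s0 * t1 / (s0 + t1) <= rho' ^+ 2 ->
  (dotv e x - c) * rho / t1 <= 3 ->
  (\int[P]_w (path_ind X e c 0 M.+1 w * path_ind X e' c' M M.+1 w *
      heat_kernel sg (X (M + M)%N w) y)%:E <=
   (two_phase_cst * ((dotv e x - c) * rho / t1) * ((dotv e' y - c') * rho' / s0) *
     heat_kernel (s0 + t1 + sg) x y)%:E)%E.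
Proof.
move=> ph; case: (ph) => walk X0 t1E s0E t10 s00 eps0 sg0 sg_eps h_hm hm_sg Meta.
move=> e1 e'1 xeps yeps al0 ga0 rho0 rho'0 eps_rho eps_rho' sgs sgt r1 r1' r2 r2' K3.
set dx := dotv e x - c in xeps r1 K3 *; set dy := dotv e' y - c' in yeps r1' *.
set al := dotv e y - c in al0 r1 *; set ga := dotv e' x - c' in ga0 r1' *.
have dx0 : 0 < dx by exact: lt_le_trans xeps.
have dy0 : 0 < dy by exact: lt_le_trans yeps.
have ss0 : 0 < sg + s0 by rewrite addr_gt0.
have ts0 : 0 < t1 + sg by rewrite addr_gt0.
have t'0 : 0 < s0 + t1 + sg by rewrite !addr_gt0.
pose Z w := path_ind X e c 0 M.+1 w.
have Z01 w : 0 <= Z w <= 1 by exact: path_ind01.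
have Z0 w : 0 <= Z w by have /andP[] := Z01 w.
have pZ : walk_past n g M Z by exact: (past_measurable_path_ind walk).
have mZ := past_measurableT (walk_measurable walk) pZ.
pose p := rho'^-1; pose y' := y + (2 * (sg + s0) * p) *: e'.
pose A1 := 2 * dy / (sg + s0) * rho' *
  expR (p * (dotv e' y - (c' - eps)) + (sg + s0) * p ^+ 2).
have A10 : 0 <= A1.
  by rewrite mulr_ge0 ?expR_ge0// mulr_ge0 ?(ltW rho'0)// divr_ge0 ?mulr_ge0 ?ltW.
have tau_ge : sg + \sum_(l < M) h (M + l)%N <= s0 + t1 + sg by rewrite s0E; lra.
have cy : c' <= dotv e' y by rewrite -subr_ge0 ltW.
apply: (le_trans (integral_heat_kernel_hs walk (leqnn _) pZ Z01 e'1 eps0 sg0 h_hm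
  hm_sg sg_eps tau_ge cy Meta)).
rewrite s0E.
pose C1 : R := 2 * expR 1.
have C10 : 0 < C1 by rewrite mulr_gt0// expR_gt0.
have hkZ w s j v : 0 <= Z w * heat_kernel s (X j w) v.
  by rewrite mulr_ge0// heat_kernel_ge0.
have mhkZ s v : 0 < s -> measurable_fun setT (fun w => Z w * heat_kernel s (X M w) v).
  exact: (measurable_path_heat_kernel _ _ _ _ _ walk).
apply: (@le_trans _ _ (C1%:E * (A1%:E * \int[P]_w (Z w * heat_kernel (sg + s0) (X M w) y')%:E))%E).
  rewrite lee_pmul2l ?lte_fin// -ge0_integralZl_EFin//; last 2 first.
  - by move=> w _; rewrite lee_fin.
  - by apply: measurable_EFin; exact: mhkZ.
  apply: le_integralT => w.
    rewrite lee_fin mulr_ge0// /hs_ind; case: ltP => cX; last by rewrite mul0r.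
    by rewrite mul1r hs_kernel_ge0//; lra.
  rewrite -EFinM lee_fin [leRHS]mulrCA ler_wpM2l//.
  exact: (hs_kernel_le_shift _ e'1 ss0 rho'0 eps0 yeps).
rewrite (integral_heat_kernel_mix P y' sg0 s00 mZ Z0); last first.
  move=> i; apply: (past_measurableT (walk_measurable walk)).
  exact: (walk_past_coord walk i (leqnn _)).
pose k := 2 * dx / (t1 + sg).
have k0 : 0 <= k by rewrite divr_ge0 ?mulr_ge0 ?(ltW dx0)// ltW.
have krho : k * rho <= 2 * (dx * rho / t1).
  have -> : k * rho = 2 * (dx * rho / (t1 + sg)) by rewrite /k; ring.
  rewrite ler_wpM2l// ler_wpM2l//; first by rewrite mulr_ge0 ?ltW.
  by rewrite lef_pV2// lerDl ltW.
(* The hypothesis [dx * rho / t1 <= 3] gives [k * rho <= 6], hence the rate [1 + 6]. The absolute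
   value in [phase1] is removed by adding the tilts by [q] and [- q]. *)
pose q := 7 / rho.
pose B0 := C1 * (k * rho * expR 7).
have B00 : 0 <= B0.
  by rewrite /B0 mulr_ge0 ?(ltW C10)// mulr_ge0 ?expR_ge0// mulr_ge0 ?(ltW rho0).
pose a q := B0 * expR (q * (dotv e y' - c) + s0 * q ^+ 2).
have a0 q' : 0 <= a q' by rewrite mulr_ge0 ?expR_ge0.
pose yy q := y' + (2 * s0 * q) *: e.
apply: (@le_trans _ _ (C1%:E * (A1%:E * lebesgue_int (fun v =>
  (a q * (heat_kernel (t1 + sg) x v * heat_kernel s0 v (yy q)) +
   a (- q) * (heat_kernel (t1 + sg) x v * heat_kernel s0 v (yy (- q))))%:E)))%E).
  rewrite lee_pmul2l ?lte_fin// lee_wpmul2l ?lee_fin//.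
  apply: lebesgue_int_le => v.
    rewrite mule_ge0 ?lee_fin ?heat_kernel_ge0//.
    by apply: integral_ge0 => w _; rewrite lee_fin.
  apply: (@le_trans _ _ ((C1 * (heat_kernel (t1 + sg) x v * (k * rho * expR 7 *
    (expR (q * (dotv e v - c)) + expR (- q * (dotv e v - c))))))%:E *
    (heat_kernel s0 v y')%:E)%E).
    rewrite lee_wpmul2r ?lee_fin ?heat_kernel_ge0//.
    apply: (le_trans (phase1 v ph e1 xeps)); rewrite -/dx -/k -/C1 lee_fin.
    rewrite ler_pM2l// ler_wpM2l ?heat_kernel_ge0//.
    have k6 : k * rho <= 6 by lra.
    apply: (le_trans (mul_expR_le rho0 k0 k6 (ltW eps0) eps_rho (normr_ge0 _))).
    rewrite (_ : 1 + 6 = 7); last by ring.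
    apply: ler_wpM2l; first by rewrite mulr_ge0 ?expR_ge0// mulr_ge0 ?(ltW rho0).
    have -> : 7 * `|dotv e v - c| / rho = `|q * (dotv e v - c)|.
      by rewrite normrM (@ger0_norm _ q) ?divr_ge0 ?(ltW rho0)// /q mulrAC.
    by rewrite mulNr expR_norm_le.
  rewrite -EFinM lee_fin /a /yy.
  rewrite le_eqVlt; apply/orP; left; apply/eqP.
  have tilt q' := heat_kernel_expR c q' v y' e1 s00.
  transitivity (B0 * heat_kernel (t1 + sg) x v *
     (heat_kernel s0 v y' * expR (q * (dotv e v - c)) +
      heat_kernel s0 v y' * expR (- q * (dotv e v - c)))); first by rewrite /B0; ring.
  by rewrite (tilt q) (tilt (- q)) mulrDr; congr (_ + _); exact: mulrACA.
rewrite lebesgue_int_heat_kernelD// -!EFinM lee_fin.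
have -> : t1 + sg + s0 = s0 + t1 + sg by ring.
(* The shifts of the endpoint along [e'] and [e] are undone together, which leaves the exponent of
   [two_tilt_exponent_le]. *)
have key q' : `|q'| = 7 / rho -> A1 * (a q' * heat_kernel (s0 + t1 + sg) x (yy q')) <=
    2 * dy / (sg + s0) * rho' * (B0 * (heat_kernel (s0 + t1 + sg) x y * expR 173)).
  move=> q'E.
  have ee : `|dotv e e'| <= 1.
    rewrite ler_norml dotv_unit_le1// andbT.
    have := @dotv_unit_le1 _ _ e (- e') e1; rewrite !dotvE opprK => /(_ e'1).
    by rewrite lerNl.
  have := two_tilt_exponent_le s00 t10 sg0 sgs sgt dx0 dy0 al0 ga0 eps0 rho0 rho'0
    eps_rho' (ler0n _ 7) r1 r1' r2 r2' (erefl p) q'E ee.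
  rewrite (_ : 5 + 10 * 7 + 2 * 7 ^+ 2 = 173); last by ring.
  set Ex := (X in X <= _) => ExLe.
  apply: (@le_trans _ _ (2 * dy / (sg + s0) * rho' *
    (B0 * (heat_kernel (s0 + t1 + sg) x y * expR Ex)))); last first.
    rewrite ler_wpM2l//; first by rewrite mulr_ge0 ?(ltW rho'0)// divr_ge0 ?mulr_ge0 ?ltW.
    by rewrite ler_wpM2l// ler_wpM2l ?heat_kernel_ge0// ler_expR.
  rewrite le_eqVlt; apply/orP; left; apply/eqP.
  rewrite /A1 /a /yy /y' -(addrA y) heat_kernel_shift//.
  set HK := heat_kernel _ _ _.
  rewrite [LHS](_ : _ = 2 * dy / (sg + s0) * rho' * (B0 * (HK *
    (expR (p * (dotv e' y - (c' - eps)) + (sg + s0) * p ^+ 2) *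
     (expR (q' * (dotv e (y + (2 * (sg + s0) * p) *: e') - c) + s0 * q' ^+ 2) *
      expR (dotv ((2 * (sg + s0) * p) *: e' + (2 * s0 * q') *: e) (x - y) /
        (2 * (s0 + t1 + sg)) -
        dotv ((2 * (sg + s0) * p) *: e' + (2 * s0 * q') *: e)
        ((2 * (sg + s0) * p) *: e' + (2 * s0 * q') *: e) / (4 * (s0 + t1 + sg)))))))); last by ring.
  rewrite -!expRD; congr (_ * (_ * (_ * expR _))).
  rewrite !dotvE e1 e'1 (dotvC e' e) /Ex /dy /dx /al /ga.
  by field; rewrite gt_eqF.
have keyq := key q; have keyNq := key (- q).
rewrite normrN in keyNq.
have qE : `|q| = 7 / rho by rewrite ger0_norm// divr_ge0// ltW.
have {keyq} := keyq qE; have {keyNq} := keyNq qE => h1 h2.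
apply: (@le_trans _ _ (C1 * (2 * dy / (sg + s0) * rho' *
  (B0 * (heat_kernel (s0 + t1 + sg) x y * expR 173)) * 2))).
  by rewrite (ler_pM2l C10) mulrDr [leRHS]mulr_natr mulr2n; exact: lerD h2 h1.
set HK := heat_kernel _ _ _.
have HK0 : 0 <= HK by exact: heat_kernel_ge0.
have h3 : 2 * dy / (sg + s0) * rho' <= 2 * (dy * rho' / s0).
  have -> : 2 * dy / (sg + s0) * rho' = 2 * (dy * rho' / (sg + s0)) by ring.
  rewrite ler_wpM2l// ler_wpM2l//; first by rewrite mulr_ge0 ?ltW.
  by rewrite lef_pV2// lerDr ltW.
have h4 : B0 <= C1 * (2 * (dx * rho / t1) * expR 7).
  by rewrite /B0 ler_pM2l// ler_wpM2r// expR_ge0.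
apply: (@le_trans _ _ (C1 * (2 * (dy * rho' / s0) *
  ((C1 * (2 * (dx * rho / t1) * expR 7)) * (HK * expR 173)) * 2))).
  have HE0 : 0 <= HK * expR 173 by rewrite (mulr_ge0 HK0)// expR_ge0.
  rewrite (ler_pM2l C10); apply: ler_wpM2r; first by [].
  apply: ler_pM h3 _; [| exact: mulr_ge0 | exact: ler_wpM2r].
  by apply: ltW; rewrite mulr_gt0// divr_gt0// mulr_gt0.
by rewrite /two_phase_cst -/C1 le_eqVlt; apply/orP; left; apply/eqP; ring.
Qed.

End two_phase.

(** * Brownian motion killed on leaving an open set *)

Section measurable_rV.
Context (R : realType) (n : nat) d (Omega : measurableType d).
Variable Y : Omega -> 'rV[R]_n.
Hypothesis mY : forall i, measurable_fun setT (fun w => Y w 0 i).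

Lemma measurable_preimage_ball (v : 'rV[R]_n) r : measurable [set w | ball v r (Y w)].
Proof.
have [r0|r0] := ltP 0 r; last first.
  rewrite (_ : [set w | _] = set0)//; apply/seteqP; split=> w //= [].
  by rewrite ltNge r0.
rewrite (_ : [set w | _] = \bigcap_(i in [set: 'I_n]) [set w | ball (v 0 i) r (Y w 0 i)]).
  apply: fin_bigcap_measurable; first exact: finite_finset.
  by move=> i _; have := mY i measurableT (measurable_ball (v 0 i) r); rewrite setTI.
apply/seteqP; split=> w /= h; first by move=> i _; have [_] := h; exact.
by split=> // i j; rewrite !ord1; exact: h.
Qed.

Lemma open_rat_ball (U : set 'rV[R]_n) z : open U -> U z ->
  exists (v : 'rV[rat]_n) (k : nat),
    ball (map_mx ratr v : 'rV[R]_n) k.+1%:R^-1 z /\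
    ball (map_mx ratr v : 'rV[R]_n) k.+1%:R^-1 `<=` U.
Proof.
move=> oU Uz; have /nbhs_ballP[e /= e0 zU] : nbhs z U by exact: open_nbhs_nbhs.
have e20 : 0 < e / 2 by rewrite divr_gt0.
have [k ke] := ltr_add_invr e20; rewrite add0r in ke.
have k0 : 0 < k.+1%:R^-1 :> R by rewrite invr_gt0.
have vP i : exists q : rat, `|ratr q - z 0 i| < k.+1%:R^-1.
  have /rat_in_itvoo[q] : z 0 i - k.+1%:R^-1 < z 0 i + k.+1%:R^-1.
    by rewrite ltrBlDr -addrA ltrDl addr_gt0.
  by rewrite in_itv/= => /andP[? ?]; exists q; rewrite ltr_distl; apply/andP.
have [v vz] := choice vP.
exists (\row_i v i), k; have bz : ball (map_mx ratr (\row_i v i) : 'rV[R]_n) k.+1%:R^-1 z.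
  by split=> // i j; rewrite !mxE !ord1; exact: vz.
split=> // u vu; apply: zU; rewrite (splitr e).
by apply: ball_triangle (ball_sym (le_ball (ltW ke) bz)) (le_ball (ltW ke) vu).
Qed.

Lemma measurable_preimage_open (U : set 'rV[R]_n) : open U ->
  measurable [set w | U (Y w)].
Proof.
move=> oU.
pose F (p : 'rV[rat]_n * nat) : set Omega :=
  if pselect (ball (map_mx ratr p.1 : 'rV[R]_n) p.2.+1%:R^-1 `<=` U)
  then [set w | ball (map_mx ratr p.1 : 'rV[R]_n) p.2.+1%:R^-1 (Y w)] else set0.
rewrite (_ : [set w | _] = \bigcup_p F p).
  apply: countable_bigcupT_measurable => // p; rewrite /F.
  by case: pselect => /= ? //; exact: measurable_preimage_ball.
apply/seteqP; split=> w /= => [/(open_rat_ball oU)[v [k [vw vU]]]|[p _]].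
  by exists (v, k) => //; rewrite /F; case: pselect.
by rewrite /F; case: pselect => // pU; exact: pU.
Qed.

End measurable_rV.

Section exit_time.
Context (R : realType) (n : nat).
Variables (D : set 'rV[R]_n) (f : R -> 'rV[R]_n) (t : R).
Hypothesis oD : open D.
Hypothesis t0 : 0 < t.
Hypothesis cf : {within `[0%R, +oo[, continuous f}.

Lemma path_nbhs s (U : set 'rV[R]_n) : 0 <= s -> nbhs (f s) U ->
  exists2 e, 0 < e & forall r, 0 <= r -> `|s - r| < e -> U (f r).
Proof.
move=> s0 nU; have /subspace_continuousP/(_ s) := cf.
rewrite /= in_itv/= s0 => /(_ isT U nU) /=.
rewrite /fmap /within /= => /nbhs_ballP[e /= e0 he].
by exists e => // r r0 sr; apply: he => //; rewrite in_itv/= r0.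
Qed.

Lemma path_compact : compact (f @` `[0, t]).
Proof.
apply: continuous_compact; last exact: segment_compact.
apply: continuous_subspaceW cf => s /=; rewrite !in_itv/= => /andP[-> //].
Qed.

(** Compactness of the path gives a uniform distance from the complement of [D]. Conversely,
    continuity passes from rational to real times, and openness of [D] at time [t] gives the strict
    inequality. The right-hand side is a countable condition, which makes survival measurable. *)
Lemma exit_time_gtP :
  (t%:E < ereal_inf [set s%:E | s in [set s : R | (0 <= s)%R /\ ~ D (f s)]])%E <->
  exists k : nat, forall q : rat, 0 <= (ratr q : R) <= t ->
    ball (f (ratr q)) (k.+1%:R^-1 : R) `<=` D.
Proof.
split=> [texit|[k kD]].
  have inD s : 0 <= s <= t -> D (f s).
    move=> /andP[s0 st]; apply: contrapT => nD.
    have : (ereal_inf [set s%:E | s in [set s : R | (0 <= s)%R /\ ~ D (f s)]] <= s%:E)%E.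
      by apply: ereal_inf_lbound; exists s.
    by move=> /(lt_le_trans texit); rewrite lte_fin ltNge st.
  have /compact_near_coveringP cov := path_compact.
  have /= := @cov R (0^'+) (fun e z => ball z e `<=` D) _.
  case=> [z [s s0t <-]|e /= e0 he].
    have /nbhs_ballP[e /= e0 zD] : nbhs (f s) D.
      by apply: open_nbhs_nbhs; split=> //; apply: inD; rewrite in_itv/= in s0t.
    have e20 : 0 < e / 2 by rewrite divr_gt0.
    exists (ball (f s) (e / 2), [set r | r < e / 2]) => /=.
      split; first exact: nbhsx_ballx.
      exact: nbhs_right_lt.
    move=> [u r] /= [su re] v uv; apply: zD; rewrite (splitr e).
    exact: ball_triangle su (le_ball (ltW re) uv).
  have e20 : 0 < e / 2 by rewrite divr_gt0.
  have [k ke] := ltr_add_invr e20; rewrite add0r in ke.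
  exists k => q q0t; apply: (he k.+1%:R^-1) => //=.
    by rewrite sub0r normrN gtr0_norm ?invr_gt0// (lt_trans ke)// gtr_pMr// invf_lt1// ltr1n.
  by exists (ratr q) => //=; rewrite in_itv.
have k0 : 0 < k.+1%:R^-1 :> R by rewrite invr_gt0.
have inD s : 0 <= s <= t -> D (f s).
  move=> /andP[s0 st].
  have [e e0 he] := path_nbhs s0 (nbhsx_ballx (f s) _ k0).
  have /rat_in_itvoo[q] : Num.max 0 (s - e) < Num.min t (s + e).
    by rewrite lt_min !gt_max t0 /= ; lra.
  rewrite in_itv/= gt_max lt_min => /andP[/andP[q0 sq] /andP[qt qs]].
  have : ball (f s) k.+1%:R^-1 (f (ratr q)).
    by apply: he; rewrite ?ltW// ltr_norml; lra.
  by move=> /ball_sym; apply: kD; rewrite !ltW.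
have tt : 0 <= t <= t by rewrite lexx ltW.
have [e e0 he] := path_nbhs (ltW t0) (open_nbhs_nbhs (conj oD (inD _ tt))).
apply: (@lt_le_trans _ _ (t + e)%:E); first by rewrite lte_fin ltrDl.
apply: le_ereal_inf_tmp => _ [s [s0 nD] <-]; rewrite lee_fin leNgt; apply/negP => ste.
apply: nD; have [st|ts] := leP s t; first by apply: inD; rewrite s0.
by apply: he => //; rewrite ltr_norml; apply/andP; split; lra.
Qed.

End exit_time.

Lemma prode_prodeD1 (R : realType) (N n : nat) (f : 'I_N -> 'I_n -> \bar R) j0 i0 :
  (\prod_(j < N) \prod_(i < n) f j i =
   f j0 i0 * (\prod_(i < n | i != i0) f j0 i *
     \prod_(j < N | j != j0) \prod_(i < n) f j i))%E.
Proof. by rewrite (bigD1 j0)//= (bigD1 i0)//= muleA. Qed.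

(** * Scalar increments of Brownian motion on a grid *)

Section brownian_walk.
Context (R : realType) (n : nat) d (Omega : measurableType d).
Variables (P : probability Omega R) (W : R -> Omega -> 'rV[R]_n).
Hypothesis n0 : (0 < n)%N.
Hypothesis bm : brownian_motion P W.

Lemma brownian_walk (s : nat -> R) (x : 'rV[R]_n) N : s 0%N = 0 ->
  (forall j, s j < s j.+1) ->
  exists g, gaussian_walk P g (fun j => s j.+1 - s j) N (fun j w => x + W (s j) w).
Proof.
move=> s0 sS; have [mW W0 _ ind] := bm.
have sge0 j : 0 <= s j by elim: j => [|j IH]; [rewrite s0|rewrite (le_trans IH)// ltW].
pose co k : 'I_n := Ordinal (ltn_pmod k n0).
pose g k w : R := 
  W (s (k %/ n)%N.+1) w 0 (co k) - W (s (k %/ n)%N) w 0 (co k).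
have gE j (i : 'I_n) w : g (j * n + i)%N w = W (s j.+1) w 0 i - W (s j) w 0 i.
  have coE : co (j * n + i)%N = i by apply/val_inj; rewrite /= modnMDl modn_small.
  by rewrite /g coE divnMDl// divn_small ?addn0.
exists g; split.
- by move=> k; apply: measurable_funB; exact: mW.
- by exists x => w; rewrite s0 W0 addr0.
- by move=> j w i; rewrite gE !mxE; ring.
- by move=> j; rewrite subr_gt0.
move=> k A B kN mA mB.
have j0N : (k %/ n < N)%N by rewrite ltn_divLR.
pose j0 : 'I_N := Ordinal j0N; pose i0 := co k.
have kE : k = (j0 * n + i0)%N by rewrite /= -divn_eq.
(* The first [k] scalar increments are constrained by [A], the next one by [C], the later ones not
   at all; [C = setT] yields the probability of the past alone. *)
pose AC (C : set R) (j : nat) (i : 'I_n) : set R :=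
  if (j * n + i < k)%N then A (j * n + i)%N
  else if (j * n + i == k)%N then C else setT.
have mAC C : measurable C -> forall j i, measurable (AC C j i).
  by move=> mC j i; rewrite /AC; case: ifP => // _; case: ifP.
have setE C : [set w | forall i, (i < k)%N -> A i (g i w)] `&` g k @^-1` C =
    [set w | forall (j : 'I_N) (i : 'I_n),
      AC C j i (W (s j.+1) w ord0 i - W (s j) w ord0 i)].
  apply/seteqP; split=> [w [h1 h2] j i|w h].
    rewrite -gE /AC; case: ifP => jik; first exact: h1.
    by case: eqP => // ->.
  split=> [i ik|].
    have iN : (i %/ n < N)%N by rewrite ltn_divLR// (ltn_trans ik).
    have := h (Ordinal iN) (co i); rewrite -gE /AC /= -divn_eq ik; exact.
  by have := h j0 i0; rewrite -gE /AC /= -divn_eq ltnn eqxx.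
pose mu j (E : set R) : \bar R := normal_prob 0 (Num.sqrt (2 * (s j.+1 - s j))) E.
have muT j : mu j setT = 1%E by exact: probability_setT.
have indE C : measurable C ->
    P ([set w | forall i, (i < k)%N -> A i (g i w)] `&` g k @^-1` C) =
    (\prod_(j < N) \prod_(i < n) mu j (AC C j i))%E.
  by move=> mC; rewrite setE ind//; exact: mAC.
rewrite -[normal_prob _ _ B]/(mu (k %/ n)%N B).
clearbody mu.
have PE C : measurable C ->
    P ([set w | forall i, (i < k)%N -> A i (g i w)] `&` g k @^-1` C) =
    (mu (k %/ n)%N C * (\prod_(i < n | i != i0) mu j0 (AC setT j0 i) *
     \prod_(j < N | j != j0) \prod_(i < n) mu j (AC setT j i)))%E.
  move=> mC; rewrite indE//.
  have EI : (\prod_(i < n | i != i0) mu j0 (AC C j0 i) =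
      \prod_(i < n | i != i0) mu j0 (AC setT j0 i))%E.
    apply: eq_bigr => i ii0; congr (mu _ _); rewrite /AC.
    rewrite (_ : (j0 * n + i == k)%N = false)//; apply/negbTE.
    by rewrite kE eqn_add2l; apply: contra ii0 => /eqP/val_inj ->.
  have EJ : (\prod_(j < N | j != j0) \prod_(i < n) mu j (AC C j i) =
      \prod_(j < N | j != j0) \prod_(i < n) mu j (AC setT j i))%E.
    apply: eq_bigr => j jj0; apply: eq_bigr => i _; congr (mu _ _); rewrite /AC.
    rewrite (_ : (j * n + i == k)%N = false)//; apply/negbTE.
    apply: contra jj0 => /eqP jik; apply/eqP/val_inj => /=.
    by rewrite -jik divnMDl// divn_small ?addn0.
  have E0 : AC C j0 i0 = C by rewrite /AC /= -divn_eq ltnn eqxx.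
  rewrite (prode_prodeD1 (fun j i => mu j (AC C j i)) j0 i0).
  by rewrite EI EJ E0.
have := PE setT measurableT; rewrite preimage_setT setIT => ->.
by rewrite PE// muT mul1e muleC.
Qed.

End brownian_walk.

Lemma ball_sqr_enorm (R : realType) n (y z : 'rV[R]_n) (l : R) : ball y l z ->
  enorm (z - y) ^+ 2 <= n%:R * l ^+ 2.
Proof.
move=> [l0 zl]; rewrite sqr_enorm /dotv (_ : n%:R * l ^+ 2 = \sum_(i < n) l ^+ 2); last first.
  by rewrite sumr_const card_ord mulr_natl.
apply: ler_sum => i _; rewrite -expr2 !mxE -(@real_normK _ (_ - _)) ?num_real//.
have := zl 0 i; rewrite /ball /= distrC => /ltW h.
by rewrite lerXn2r ?nnegrE ?(ltW l0).
Qed.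

(** * From survival probabilities to the density *)

Section killed.
Context (R : realType) (n : nat) d (Omega : measurableType d).
Variables (P : probability Omega R) (W : R -> Omega -> 'rV[R]_n).
Hypothesis bm : brownian_motion P W.
Implicit Types (D : set 'rV[R]_n) (x y z : 'rV[R]_n).

Let X x s w := x + W s w.

Lemma measurable_brownian x s : 0 <= s -> forall i,
  measurable_fun setT (fun w => X x s w 0 i).
Proof.
move=> s0 i; have [mW _ _ _] := bm.
rewrite (_ : (fun w => _) = fun w => x 0 i + W s w 0 i).
  by apply: measurable_funD => //; exact: mW.
by apply/funext => w; rewrite /X mxE.
Qed.

Lemma brownian_continuous x w : {within `[0%R, +oo[, continuous (X x ^~ w)}.
Proof.
have [_ _ cW _] := bm; apply/subspace_continuousP => s s0.
have /subspace_continuousP/(_ s s0) cWs := cW w.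
by apply: cvgD => //; exact: cvg_cst.
Qed.

Lemma open_not_ball_sub D (r : R) : open [set z | ~ (ball z r `<=` D)].
Proof.
rewrite (_ : [set z | _] = \bigcup_(u in ~` D) (ball u r : set 'rV[R]_n)).
  apply: bigcup_open => u _; exact: ball_open.
apply/seteqP; split=> z /=.
  by move=> /existsNP[u /not_implyP[zu nDu]]; exists u => //; exact: ball_sym.
by move=> [u nDu uz] /(_ u (ball_sym uz)).
Qed.

Lemma measurable_exit D x t : open D -> 0 < t ->
  measurable [set w | (t%:E < exit_time (X x) D w)%E].
Proof.
move=> oD t0.
rewrite (_ : [set w | _] = \bigcup_k ~` \bigcup_(q : rat)
    (if 0 <= (ratr q : R) <= t then
      [set w | ~ (ball (X x (ratr q) w) (k.+1%:R^-1 : R) `<=` D)] else set0)).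
  apply: bigcupT_measurable => k; apply: measurableC.
  apply: bigcupT_measurable_rat => q; case: ifP => // /andP[q0 _].
  exact: (measurable_preimage_open (measurable_brownian x q0)
    (@open_not_ball_sub D (k.+1%:R^-1))).
apply/seteqP; split=> w /=.
  move=> /(exit_time_gtP oD t0 (@brownian_continuous x w))[k kD].
  by exists k => // -[q _]; case: ifP => // /kD.
move=> [k _ nk]; apply/(exit_time_gtP oD t0 (@brownian_continuous x w)).
exists k => q q0t; apply: contrapT => nb; apply: nk; exists q => //.
by rewrite q0t.
Qed.

Lemma exit_time_gt_in D x t w s : (t%:E < exit_time (X x) D w)%E ->
  0 <= s -> s <= t -> D (X x s w).
Proof.
move=> texit s0 st; apply: contrapT => nD.
have : (exit_time (X x) D w <= s%:E)%E by apply: ereal_inf_lbound; exists s.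
by move=> /(lt_le_trans texit); rewrite lte_fin ltNge st.
Qed.

(** The inverse of the value of [(2 * l) ^ n * heat_kernel (l ^ 2)] at squared Euclidean distance
    [n * l ^ 2], the largest possible in a cube of half-side [l]; it does not depend on [l]. *)
Definition cube_cst : R := expR (n%:R / 4) * (4 * pi) `^ (n%:R / 2) / 2 ^+ n.

Lemma cube_cst_gt0 : 0 < cube_cst.
Proof.
by rewrite divr_gt0 ?exprn_gt0// mulr_gt0 ?expR_gt0// powR_gt0// mulr_gt0// pi_gt0.
Qed.

Lemma heat_kernel_cube l y z : 0 < l -> ball y l z ->
  1 <= cube_cst * (2 * l) ^+ n * heat_kernel (l ^+ 2) z y.
Proof.
move=> l0 yz; have l20 : 0 < l ^+ 2 by rewrite exprn_gt0.
have p0 := pi_gt0 R.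
have p4 : 0 < 4 * pi :> R by rewrite mulr_gt0.
have q0 : 0 < 4 * pi * l ^+ 2 by rewrite mulr_gt0.
have -> : cube_cst * (2 * l) ^+ n =
    expR (n%:R / 4) * (4 * pi * l ^+ 2) `^ (n%:R / 2).
  rewrite /cube_cst exprMn (@powRM _ (4 * pi) (l ^+ 2)) ?(ltW l20) ?(ltW p4)//.
  have -> : (l ^+ 2) `^ (n%:R / 2) = l ^+ n.
    have l_ge0 := ltW l0; rewrite -!powR_mulrn// -powRrM.
    by congr (_ `^ _); field.
  by field; rewrite expf_neq0.
rewrite /heat_kernel [_ * expR _]mulrC mulrACA -powRD; last by rewrite (gt_eqF q0) implybT.
rewrite subrr powRr0 mulr1 -expRD -[leLHS]expR0 ler_expR.
have h := ball_sqr_enorm yz.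
by rewrite subr_ge0 ler_pdivrMr ?mulr_gt0// mulrA divfK.
Qed.

(** By continuity, the probability of surviving and ending in a small cube is at least about [p y]
    times its volume. The indicator of the cube is at most [cube_cst] times the volume times a
    Gaussian of time [l ^ 2], and the volume cancels. The majorant [f] of survival may depend on
    [l], so its time grid can be adapted to [l]. *)
Lemma dirichlet_heat_kernel_le (D : set 'rV[R]_n) (p : 'rV[R]_n -> R) x y (t B : R) :
  open D -> D y -> 0 < t -> (forall z, D z -> 0 <= p z) -> {for y, continuous p} ->
  (forall A : set 'rV[R]_n, <<s [set U : set 'rV[R]_n | open U] >> A -> A `<=` D ->
    P [set w | A (X x t w) /\ (t%:E < exit_time (X x) D w)%E] =
    lebesgue_int (fun z => (p z * \1_A z)%:E)) ->
  0 <= B ->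
  (forall l0, 0 < l0 -> exists2 l, 0 < l < l0 & exists f : Omega -> R,
    [/\ measurable_fun setT f, forall w, 0 <= f w,
        forall w, (forall s, 0 <= s -> s <= t -> D (X x s w)) -> 1 <= f w &
        (\int[P]_w (f w * heat_kernel (l ^+ 2) (X x t w) y)%:E <= B%:E)%E]) ->
  p y <= cube_cst * B.
Proof.
move=> oD Dy t0 p0 cp PA B0 HB; apply/ler_addgt0Pl => eta eta0; rewrite -lerBlDl.
have [//|c0] := leP (p y - eta) 0.
  by move=> /le_trans; apply; rewrite mulr_ge0// ltW// cube_cst_gt0.
have : nbhs y [set z | D z /\ p y - eta < p z].
  apply: filterI; first exact: open_nbhs_nbhs.
  have /cvgrPdist_lt/(_ _ eta0) : p z @[z --> y] --> p y by exact: cp.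
  apply: filterS => z /=; rewrite ltr_norml => /andP[_]; lra.
move=> /nbhs_ballP[l0 /= l00 yl0]; have [l /andP[l_gt0 ll0] [f [mf f0 f1 fB]]] := HB _ l00.
pose A : set 'rV[R]_n := ball y l.
have AD z : A z -> D z /\ p y - eta < p z.
  by move=> Az; apply: yl0; exact: le_ball (ltW ll0) _ Az.
have sA : <<s [set U : set 'rV[R]_n | open U] >> A.
  by apply: sub_sigma_algebra => /=; exact: ball_open.
have := PA A sA (fun z Az => (AD z Az).1).
set Ev := [set w | _] => PEv.
have mEv : measurable Ev.
  apply: measurableI; last exact: measurable_exit.
  by apply: measurable_preimage_ball; exact: measurable_brownian (ltW t0).
have l20 : 0 < l ^+ 2 by rewrite exprn_gt0.
have K0 : 0 < cube_cst * (2 * l) ^+ n.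
  by rewrite mulr_gt0 ?cube_cst_gt0// exprn_gt0// mulr_gt0.
have lower : (((p y - eta) * (2 * l) ^+ n)%:E <= P Ev)%E.
  rewrite PEv; pose I (i : 'I_n) r : R := \1_(ball (y 0 i) l) r.
  have I0 i r : 0 <= I i r by rewrite /I indicE.
  have mI i : measurable_fun setT (I i).
    by apply: measurable_indic; exact: measurable_ball.
  have II i : (\int[lebesgue_measure]_r (I i r)%:E = (2 * l)%:E)%E.
    rewrite integral_indic//; last exact: measurable_ball.
    rewrite setIT; apply: etrans (lebesgue_measure_ball (y 0 i) (ltW l_gt0)) _.
    by rewrite mulr_natl.
  have := lebesgue_int_prodD (ltW c0) (lexx 0) I0 I0 mI mI II II.
  rewrite mul0r addr0 prodr_const card_ord => <-.
  apply: lebesgue_int_le => z.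
    by rewrite lee_fin mul0r addr0 mulr_ge0// ?(ltW c0)// prodr_ge0.
  rewrite lee_fin mul0r addr0 indicE; case: (boolP (z \in A)) => [/set_mem Az|nAz].
    rewrite mulr1; have [_ h] := AD z Az; apply: le_trans (ltW h).
    rewrite ger_pMr//; apply: prodr_ile1 => i _.
    by rewrite I0/= /I indicE lern1 leq_b1.
  rewrite mulr0 mulr_ge0_le0 ?(ltW c0)// le_eqVlt; apply/orP; left; apply/eqP.
  have [i ni] : exists i, ~ ball (y 0 i) l (z 0 i).
    apply: contrapT => /forallNP h; move/negP: nAz; apply; apply/mem_set.
    by split=> // i j; rewrite !ord1; apply: contrapT; exact: h.
  by apply/eqP; rewrite prodf_seq_eq0; apply/hasP; exists i;
    rewrite ?mem_index_enum//= /I indicE memNset.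
have upper : (P Ev <= (cube_cst * (2 * l) ^+ n * B)%:E)%E.
  rewrite EFinM; apply: le_trans (lee_wpmul2l _ fB); last by rewrite lee_fin ltW.
  rewrite -ge0_integralZl_EFin ?(ltW K0)//; last 2 first.
  - by move=> w _; rewrite lee_fin mulr_ge0// heat_kernel_ge0.
  - apply: measurable_EFin; apply: measurable_funM => //.
    rewrite (_ : (fun w => _) = fun w => \prod_(i < n) gauss1 (l ^+ 2) (X x t w 0 i) (y 0 i)).
      apply: measurable_funP_prod => i _; apply: (measurableT_comp (measurable_gauss1l _ _)).
      exact: measurable_brownian (ltW t0) _.
    by apply/funext => w; rewrite heat_kernel_prod.
  rewrite -(setIT Ev) -integral_indic//; apply: le_integralT => w.
    by rewrite lee_fin indicE.
  rewrite -EFinM lee_fin indicE; case: (boolP (w \in Ev)) => [/set_mem[wA wt]|_].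
    rewrite mulrCA -[leLHS]mulr1 /= ler_pM//.
      by apply: f1 => s s0 st; exact: exit_time_gt_in wt s0 st.
    exact: heat_kernel_cube.
  by rewrite mulr_ge0 ?(ltW K0)// mulr_ge0// heat_kernel_ge0.
have := le_trans lower upper; rewrite lee_fin.
by rewrite mulrAC ler_pM2r// exprn_gt0// mulr_gt0.
Qed.

End killed.

(** * Distance to the boundary *)

Section geometry.
Context {R : realType} {n : nat}.
Implicit Types (D H : set 'rV[R]_n) (x y z e : 'rV[R]_n) (c : R).

Lemma enormZ (a : R) x : enorm (a *: x) = `|a| * enorm x.
Proof.
by rewrite /enorm dotvZl dotvZr mulrA -expr2 sqrtrM ?sqr_ge0// sqrtr_sqr.
Qed.

Lemma enorm_unit e : dotv e e = 1 -> enorm e = 1.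
Proof. by rewrite /enorm => ->; rewrite sqrtr1. Qed.

Lemma halfspace_unit H : halfspace H ->
  exists e c, dotv e e = 1 /\ H = [set z | c < dotv e z].
Proof.
move=> [nu [c [nu0 ->]]].
have nn0 : 0 < dotv nu nu.
  rewrite lt_neqAle dotv_ge0 andbT eq_sym; apply: contra nu0 => /eqP h.
  apply/eqP/rowP => i; rewrite mxE; apply/eqP; rewrite -sqrf_eq0 expr2.
  have := h; rewrite /dotv => /eqP; rewrite psumr_eq0 => [|j _]; last first.
    by rewrite -expr2 sqr_ge0.
  by move=> /allP/(_ i (mem_index_enum _)).
have en0 : 0 < enorm nu by rewrite sqrtr_gt0.
exists ((enorm nu)^-1 *: nu), (c / enorm nu); split.
  by rewrite dotvZl dotvZr mulrA -sqr_enorm expr2 -invfM mulVf// mulf_neq0// gt_eqF.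
apply/seteqP; split=> z /=; rewrite dotvZl [_^-1 * _]mulrC ltr_pM2r ?invr_gt0//.
Qed.

Lemma closure_halfspace e c z : dotv e e = 1 ->
  closure [set z | c < dotv e z] z -> c <= dotv e z.
Proof.
move=> e1 cz; rewrite leNgt; apply/negP => zc.
pose del := c - dotv e z; have del0 : 0 < del by rewrite subr_gt0.
(* Balls are taken in the sup norm; with this radius [n * r ^ 2 < del ^ 2]. *)
pose r := del / n.+1%:R; have r0 : 0 < r by rewrite divr_gt0.
have [u [/= cu zu]] := cz _ (nbhsx_ballx z r r0).
have h1 := dotv_unit_sqr (u - z) e1.
have h2 := ball_sqr_enorm zu.
rewrite sqr_enorm in h2.
have h3 : n%:R * r ^+ 2 < del ^+ 2.
  rewrite /r expr_div_n mulrA ltr_pdivrMr ?exprn_gt0// mulrC ltr_pM2l ?exprn_gt0//.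
  by rewrite -natrX ltr_nat expnS expn1 mulSn ltn_addr.
have h4 : del < dotv e (u - z) by rewrite /del !dotvE; lra.
have : del ^+ 2 < dotv e (u - z) ^+ 2.
  by rewrite ltrXn2r ?nnegrE// ?(ltW del0)// (le_trans (ltW del0))// ltW.
lra.
Qed.

Lemma dist_boundary_halfspace e c z : dotv e e = 1 -> c < dotv e z ->
  dist_boundary [set z | c < dotv e z] z = dotv e z - c.
Proof.
move=> e1 cz; set H := [set z | _]; set dz := dotv e z - c.
have dz0 : 0 < dz by rewrite subr_gt0.
pose z0 := z - dz *: e.
have ez0 : dotv e z0 = c by rewrite /z0 /dz !dotvE e1; ring.
have bz0 : boundary H z0.
  split; last by move=> /interior_subset; rewrite /H /= ez0 ltxx.
  move=> U /nbhs_ballP[r /= r0 rU].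
  pose a := r / (2 * (1 + `|e|)).
  have a0 : 0 < a by rewrite divr_gt0 ?mulr_gt0 ?ltr_pwDl.
  exists (z0 + a *: e); split; first by rewrite /H /= dotvDr dotvZr e1 mulr1 ez0 ltrDl.
  apply: rU; rewrite -ball_normE /= opprD addrA subrr sub0r normrN normrZ gtr0_norm//.
  have : a * (2 * (1 + `|e|)) = r by rewrite /a divfK// gt_eqF// mulr_gt0// ltr_pwDl.
  have := normr_ge0 e; nra.
have lb : lbound [set enorm (z - u) | u in boundary H] dz.
  move=> _ [u [cu nu] <-].
  have uc : dotv e u <= c.
    rewrite leNgt; apply/negP => cu'; apply: nu; apply: contrapT => nint.
    have Ne1 : dotv (- e) (- e) = 1 by rewrite !dotvE opprK.
    (* If [u] were not interior, each of its neighbourhoods would leave [H] and so meet this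
       opposite half-space, whose closure does not contain [u]. *)
    have : closure [set z | - ((dotv e u + c) / 2) < dotv (- e) z] u.
      move=> U nU; apply: contrapT => nUz; apply: nint; apply: filterS nU => v Uv.
      rewrite /H /= ltNge; apply/negP => vc; apply: nUz; exists v; split=> //=.
      by rewrite dotvNl ltrN2; lra.
    by move=> /(closure_halfspace Ne1); rewrite dotvNl; lra.
  by rewrite (le_trans _ (dotv_unit_le _ e1))// /dz !dotvE; lra.
apply/eqP; rewrite eq_le; apply/andP; split.
  have -> : dz = enorm (z - z0).
    by rewrite /z0 opprB addrC subrK enormZ (enorm_unit e1) mulr1 gtr0_norm.
  by apply: ge_inf; [exists dz|exists z0].
by apply: lb_le_inf => //; exists (enorm (z - z0)); exists z0.
Qed.

Lemma exists_boundary D y z0 : open D -> D y -> ~ D z0 ->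
  exists2 b, boundary D b & enorm (y - b) <= enorm (y - z0).
Proof.
move=> oD Dy nDz.
pose ga (s : R) := y + s *: (z0 - y).
(* [S] need not be an interval: the point at its supremum is a limit of points of [D], and openness
   with [~ D z0] keeps it out of [D]. *)
pose S := [set s : R | 0 <= s <= 1 /\ D (ga s)].
have g0 : ga 0 = y by rewrite /ga scale0r addr0.
have g1 : ga 1 = z0 by rewrite /ga scale1r addrC subrK.
have S0 : S 0 by split; [rewrite lexx ler01|rewrite g0].
have hS : has_sup S by split; [exists 0|exists 1 => s [/andP[]]].
pose u := sup S.
have u01 : 0 <= u <= 1.
  apply/andP; split; first exact: sup_upper_bound S0.
  by apply: ge_sup; [exists 0|move=> s [/andP[]]].
have near_ga s (U : set 'rV[R]_n) : nbhs (ga s) U ->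
    exists2 a, 0 < a & forall s', `|s - s'| < a -> U (ga s').
  move=> /nbhs_ballP[r /= r0 rU].
  pose a := r / (1 + `|z0 - y|).
  have N0 : 0 < 1 + `|z0 - y| by rewrite ltr_pwDl.
  have a0 : 0 < a by rewrite divr_gt0.
  exists a => // s' ss'; apply: rU; rewrite -ball_normE /= /ga.
  have -> : y + s *: (z0 - y) - (y + s' *: (z0 - y)) = (s - s') *: (z0 - y).
    by rewrite opprD addrACA subrr add0r scalerBl.
  rewrite normrZ; have : a * (1 + `|z0 - y|) = r by rewrite /a divfK// gt_eqF.
  have := normr_ge0 (z0 - y); have := normr_ge0 (s - s'); nra.
exists (ga u); last first.
  rewrite /ga opprD addrA subrr sub0r -scaleNr enormZ normrN ger0_norm; last by case/andP: u01.
  rewrite -(opprB y z0) -scaleN1r enormZ normrN1 mul1r ler_piMl ?sqrtr_ge0//.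
  by case/andP: u01.
split.
  move=> U /near_ga[a a0 aU]; have [s Ss us] := sup_adherent a0 hS.
  exists (ga s); split; first by case: Ss.
  apply: aU; rewrite ger0_norm; first by rewrite -/u in us; lra.
  by rewrite subr_ge0; exact: sup_upper_bound.
move=> /interior_subset Du.
have [a a0 aD] := near_ga _ _ (open_nbhs_nbhs (conj oD Du)).
have [u1|u1] := ltP u 1; last first.
  by apply: nDz; rewrite -g1 (_ : 1 = u)//; apply/eqP; rewrite eq_le u1; case/andP: u01.
pose s := Num.min 1 (u + a / 2).
have us : u < s by rewrite lt_min u1/= ltrDl divr_gt0.
have : s <= u.
  apply: sup_upper_bound => //; split.
    by rewrite (le_trans _ (ltW us)) /= ?ge_min ?lexx//; case/andP: u01.
  apply: aD; rewrite ltr0_norm ?subr_lt0// opprB.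
  have : s <= u + a / 2 by rewrite ge_min lexx orbT.
  lra.
by rewrite leNgt us.
Qed.

(** The foot of the perpendicular from [y] to the hyperplane is outside [D], so the segment to it
    meets the boundary of [D]. *)
Lemma dist_boundary_le D e c y : dotv e e = 1 -> open D -> D y ->
  D `<=` [set z | c < dotv e z] -> dist_boundary D y <= dotv e y - c.
Proof.
move=> e1 oD Dy DH; have cy := DH _ Dy; rewrite /= in cy.
pose z0 := y - (dotv e y - c) *: e.
have nDz : ~ D z0.
  by move=> /DH; rewrite /= /z0 !dotvE e1 mulr1 subKr ltxx.
have [b bb yb] := exists_boundary oD Dy nDz.
have -> : dotv e y - c = enorm (y - z0).
  by rewrite /z0 opprB (addrC y) subrK enormZ (enorm_unit e1) mulr1 gtr0_norm ?subr_gt0.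
apply: le_trans yb; apply: ge_inf; last by exists b.
by exists 0 => _ [? _ <-]; exact: sqrtr_ge0.
Qed.

End geometry.

(** * The heat kernel estimates *)

Section real_lemmas.
Context {R : realType}.
Implicit Types (a b K t : R).

Lemma mesh_small a K : 0 < a -> 0 <= K ->
  exists N : nat, forall M, (N <= M)%N -> (0 < M)%N ->
    M%:R * (expR (- (a * M%:R)) * K) <= 1.
Proof.
move=> a0 K0; have a20 : 0 < a ^+ 2 by rewrite exprn_gt0.
have K' : 0 <= 4 * K / a ^+ 2 by rewrite divr_ge0 ?(ltW a20)// mulr_ge0.
exists (Num.bound (4 * K / a ^+ 2)) => M NM M0.
have Mr : 0 < M%:R :> R by rewrite ltr0n.
have KM : 4 * K <= a ^+ 2 * M%:R.
  rewrite [_ ^+ 2 * _]mulrC -ler_pdivrMr//; apply: (le_trans (ltW (archi_boundP K'))).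
  by rewrite ler_nat.
have u0 : 0 < a * M%:R / 2 by rewrite divr_gt0 ?mulr_gt0.
have h : (a * M%:R / 2) ^+ 2 <= expR (a * M%:R).
  have -> : expR (a * M%:R) = expR (a * M%:R / 2) ^+ 2.
    by rewrite -expRM_natl; congr expR; field.
  rewrite lerXn2r ?nnegrE ?(ltW u0) ?expR_ge0//.
  by apply: le_trans (expR_ge1Dx _); rewrite lerDr.
rewrite expRN mulrCA ler_pdivrMl ?expR_gt0// mulr1; apply: le_trans h.
rewrite (_ : (a * M%:R / 2) ^+ 2 = M%:R * (a ^+ 2 * M%:R / 4)); last by field.
by rewrite ler_wpM2l ?(ltW Mr)// ler_pdivlMr// [K * 4]mulrC.
Qed.

Lemma exists_small_square l0 b : 0 < l0 -> 0 < b ->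
  exists2 l : R, 0 < l < l0 & l ^+ 2 <= b.
Proof.
move=> l00 b0; pose l := Num.min (l0 / 2) (Num.min 1 b).
have l_gt0 : 0 < l by rewrite !lt_min b0 ltr01 divr_gt0.
have l1 : l <= 1 by rewrite !ge_min lexx orbT.
have lb : l <= b by rewrite !ge_min lexx !orbT.
have ll : l <= l0 / 2 by rewrite ge_min lexx.
exists l; first by rewrite l_gt0/= (le_lt_trans ll)// gtr_pMr// invf_lt1// ltr1n.
by apply: le_trans lb; rewrite expr2 ger_pMr.
Qed.

End real_lemmas.

(** * The two-phase time grid *)

Section grid.
Context {R : realType}.
Variables (t1 s0 : R) (M : nat).
Hypothesis M0 : (0 < M)%N.

(** The second formula continues beyond [M + M], so that every increment is positive, as
    [gaussian_walk] asks at all indices. *)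
Definition two_phase_grid (j : nat) : R :=
  if (j <= M)%N then j%:R * (t1 / M%:R) else t1 + (j - M)%N%:R * (s0 / M%:R).

Let Mr : M%:R != 0 :> R. Proof. by rewrite pnatr_eq0 -lt0n. Qed.

Lemma two_phase_grid0 : two_phase_grid 0 = 0.
Proof. by rewrite /two_phase_grid mul0r. Qed.

Lemma two_phase_grid_diff j : two_phase_grid j.+1 - two_phase_grid j =
  if (j < M)%N then t1 / M%:R else s0 / M%:R.
Proof.
rewrite /two_phase_grid; case: ltnP => [jM|Mj].
  by rewrite (ltnW jM) -mulrBl -natr1 addrAC subrr add0r mul1r.
rewrite leq_eqVlt ltnNge Mj orbF; case: eqP => [->|_].
  by rewrite subSnn; field.
rewrite subSn// -natr1; ring.
Qed.

Lemma two_phase_grid_end : two_phase_grid (M + M) = t1 + s0.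
Proof.
rewrite /two_phase_grid -[X in (_ <= X)%N]addn0 leq_add2l leqNgt M0 addnK.
by field.
Qed.

Lemma two_phase_grid_sum1 :
  \sum_(l < M) (two_phase_grid l.+1 - two_phase_grid l) = t1.
Proof.
under eq_bigr do rewrite two_phase_grid_diff ltn_ord.
by rewrite sumr_const card_ord -mulr_natl; field.
Qed.

Lemma two_phase_grid_sum2 :
  \sum_(l < M) (two_phase_grid (M + l).+1 - two_phase_grid (M + l)) = s0.
Proof.
under eq_bigr do rewrite two_phase_grid_diff ltnNge leq_addr /=.
by rewrite sumr_const card_ord -mulr_natl; field.
Qed.

End grid.

Section brownian_phases.
Context (R : realType) (n : nat) d (Omega : measurableType d).
Variables (P : probability Omega R) (W : R -> Omega -> 'rV[R]_n).
Hypothesis n0 : (0 < n)%N.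
Hypothesis bm : brownian_motion P W.

Lemma brownian_phases x (t1 s0 eps sg : R) : 0 < t1 -> 0 < s0 -> 0 < eps ->
  0 < sg -> sg <= eps ^+ 2 ->
  exists (M : nat) (s : nat -> R) (g : nat -> Omega -> R) (hm : R),
  [/\ phases P g (fun j => s j.+1 - s j) M (fun j w => x + W (s j) w) x t1 s0 eps sg hm,
      s (M + M)%N = t1 + s0,
      forall j, (j <= M + M)%N -> 0 <= s j <= t1 + s0 &
      (M + M)%:R * (expR (- (eps ^+ 2 / (8 * hm))) /
        (1 - expR (- (eps ^+ 2 / (s0 + t1 + sg))))) <= 1].
Proof.
move=> t10 s00 eps0 sg0 sg_eps.
have e20 : 0 < eps ^+ 2 by rewrite exprn_gt0.
have T0 : 0 < t1 + s0 by rewrite addr_gt0.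
have k0 : 0 < 1 - expR (- (eps ^+ 2 / (s0 + t1 + sg))).
  by rewrite subr_gt0 expR_lt1 oppr_lt0 divr_gt0// !addr_gt0.
set K := (1 - expR (- (eps ^+ 2 / (s0 + t1 + sg)))) in k0 *.
have a0 : 0 < eps ^+ 2 / (8 * (t1 + s0)) by rewrite divr_gt0// mulr_gt0.
(* The 2 allows for [M + M] steps, since the bound with a single half-space runs over the whole
   grid. The second summand of [M] below ensures [hm <= sg]. *)
have [N1 hN1] := mesh_small a0 (ltW (mulr_gt0 (ltr0n _ 2 : 0 < 2 :> R) (divr_gt0 ltr01 k0))).
pose M := (N1 + (Num.bound ((t1 + s0) / sg)).+1)%N.
have M0 : (0 < M)%N by rewrite /M addnS.
have Mr : 0 < M%:R :> R by rewrite ltr0n.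
pose s := two_phase_grid t1 s0 M; pose hm := (t1 + s0) / M%:R.
have sd := two_phase_grid_diff t1 s0 M0.
have sS j : s j < s j.+1 by rewrite -subr_gt0 sd; case: ifP => _; rewrite divr_gt0.
have s00' : s 0%N = 0 by exact: two_phase_grid0.
have send : s (M + M)%N = t1 + s0 by exact: two_phase_grid_end.
have smono : {homo s : i j / (i <= j)%N >-> i <= j}.
  by apply: homo_leq => // [? ? ?|j]; [exact: le_trans|exact: ltW].
have [g walk] := brownian_walk n0 bm x (M + M) s00' sS.
have mesh2 : (M + M)%:R * (expR (- (eps ^+ 2 / (8 * hm))) / K) <= 1.
  have := hN1 M (leq_addr _ _) M0.
  have -> : eps ^+ 2 / (8 * (t1 + s0)) * M%:R = eps ^+ 2 / (8 * hm).
    by rewrite /hm; field; rewrite !gt_eqF.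
  by apply: le_trans; rewrite natrD le_eqVlt; apply/orP; left; apply/eqP; ring.
exists M, s, g, hm; split => //; last first.
  by move=> j jM; rewrite -[X in X <= _ <= _]s00' -send !smono.
split => //.
- by move=> w; rewrite s00'; have [_ -> _ _] := bm; rewrite addr0.
- exact: two_phase_grid_sum1.
- exact: two_phase_grid_sum2.
- move=> j; rewrite sd /hm; case: ifP => _; rewrite ler_wpM2r ?invr_ge0 ?(ltW Mr)//.
    by rewrite lerDl ltW.
  by rewrite lerDr ltW.
- rewrite /hm ler_pdivrMr// mulrC -ler_pdivrMr//.
  have q0 : 0 <= (t1 + s0) / sg by rewrite divr_ge0 ?ltW.
  apply: (le_trans (ltW (archi_boundP q0))).
  by rewrite ler_nat /M -addSnnS addSn ltnW// ltnS leq_addl.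
- apply: le_trans mesh2; rewrite ler_wpM2r ?divr_ge0 ?expR_ge0 ?(ltW k0)//.
  by rewrite ler_nat leq_addr.
Qed.

End brownian_phases.

(** Removes the extra time [sg]: the prefactor does not increase with time, and the hypothesis
    bounds the change of the exponent by 1. *)
Lemma heat_kernel_time_le (R : realType) n (x y : 'rV[R]_n) (t s : R) :
  0 < t -> 0 <= s -> s * enorm (x - y) ^+ 2 <= 4 * t ^+ 2 ->
  heat_kernel (t + s) x y <= expR 1 * heat_kernel t x y.
Proof.
move=> t0 s0 st; have ts0 : 0 < t + s by rewrite ltr_pwDl.
have p0 := pi_gt0 R.
rewrite /heat_kernel [leRHS]mulrCA -expRD ler_pM ?powR_ge0 ?expR_ge0//.
  rewrite !powRN lef_pV2 ?posrE ?powR_gt0 ?mulr_gt0//.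
  rewrite ge0_ler_powR ?nnegrE ?divr_ge0 ?mulr_ge0 ?(ltW p0) ?(ltW t0) ?(ltW ts0)//.
  by rewrite ler_wpM2l ?mulr_ge0 ?(ltW p0)// lerDl.
rewrite ler_expR; set E := enorm (x - y) ^+ 2 in st *.
have E0 : 0 <= E by exact: sqr_ge0.
suff : E / (4 * t) - E / (4 * (t + s)) <= 1 by lra.
have -> : E / (4 * t) - E / (4 * (t + s)) = s * E / (4 * t * (t + s)).
  by field; rewrite !gt_eqF.
rewrite ler_pdivrMr ?mulr_gt0// mul1r (le_trans st)// -mulrA ler_pM2l// expr2.
by rewrite ler_pM2l// lerDl.
Qed.

(* The witness is [k = max(al, r) / max(ga, r)]; its square will be the ratio of the
   durations of the second and the first phase. *)
Lemma balanced_split (R : realType) (t r dx dy al ga : R) :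
  0 < r -> r ^+ 2 = t -> 0 < dx -> 0 < dy -> dy <= al -> dx <= ga ->
  dx * al <= t -> dy * ga <= t ->
  exists k, [/\ 0 < k, dx * k <= r, dy <= r * k,
    r * al <= k * (al * ga + t) & r * ga * k <= al * ga + t].
Proof.
move=> r0 rt dx0 dy0 dyal dxga dxal dyga.
have t0 : 0 < t by rewrite -rt exprn_gt0.
have al0 : 0 < al by exact: lt_le_trans dyal.
have ga0 : 0 < ga by exact: lt_le_trans dxga.
pose A := Num.max al r; pose B := Num.max ga r.
have A0 : 0 < A by rewrite lt_max al0.
have B0 : 0 < B by rewrite lt_max ga0.
have alA : al <= A by rewrite le_max lexx.
have gaB : ga <= B by rewrite le_max lexx.
have rA : r <= A by rewrite le_max lexx orbT.
have rB : r <= B by rewrite le_max lexx orbT.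
have AP : A = al \/ A = r by rewrite /A; case: leP; [right|left].
have BP : B = ga \/ B = r by rewrite /B; case: leP; [right|left].
exists (A / B); split; first by rewrite divr_gt0.
- by rewrite mulrA ler_pdivrMr//; case: AP => ->; nra.
- by rewrite mulrA ler_pdivlMr//; case: BP => ->; nra.
- rewrite mulrAC ler_pdivlMr// mulrDr.
  have h1 : r * (al * ga) <= A * (al * ga) by rewrite ler_pM2r// mulr_gt0.
  have h2 : al * t <= A * t by rewrite ler_pM2r.
  case: BP => ->; first by rewrite -mulrA (le_trans h1)// lerDl mulr_ge0 ?ltW.
  have -> : r * al * r = al * t by rewrite -rt; ring.
  by rewrite (le_trans h2)// lerDr mulr_ge0 ?mulr_ge0 ?ltW.
- rewrite mulrA ler_pdivrMr// mulrDl.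
  have h1 : al * ga * r <= al * ga * B by rewrite ler_pM2l// mulr_gt0.
  have h2 : t * ga <= t * B by rewrite ler_pM2l.
  case: AP => ->.
    have -> : r * ga * al = al * ga * r by ring.
    by rewrite (le_trans h1)// lerDl mulr_ge0 ?ltW.
  have -> : r * ga * r = t * ga by rewrite -rt; ring.
  by rewrite (le_trans h2)// lerDr mulr_ge0 ?mulr_ge0 ?ltW.
Qed.

(** * Bounds from one and from two half-spaces *)

Section dirichlet_bounds.
Context (R : realType) (n : nat) d (Omega : measurableType d).
Variables (P : probability Omega R) (W : R -> Omega -> 'rV[R]_n).
Hypothesis n0 : (0 < n)%N.
Hypothesis bm : brownian_motion P W.
Variables (D : set 'rV[R]_n) (p : 'rV[R]_n -> R) (x y : 'rV[R]_n) (t : R).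
Hypothesis oD : open D.
Hypothesis Dx : D x.
Hypothesis Dy : D y.
Hypothesis t0 : 0 < t.
Hypothesis p0 : forall z, D z -> 0 <= p z.
Hypothesis cp : {for y, continuous p}.
Hypothesis PA : forall A : set 'rV[R]_n,
  <<s [set U : set 'rV[R]_n | open U] >> A -> A `<=` D ->
  P [set w | A (x + W t w) /\ (t%:E < exit_time (fun s w => x + W s w)%R D w)%E] =
  lebesgue_int (fun z => (p z * \1_A z)%:E).

Lemma path_ind_in (s : nat -> R) j0 m e c w : D `<=` [set z | c < dotv e z] ->
  (forall r, 0 <= r -> r <= t -> D (x + W r w)) ->
  (forall j, (j < j0 + m)%N -> 0 <= s j <= t) ->
  path_ind (fun j w => x + W (s j) w) e c j0 m w = 1.
Proof.
move=> DH inD st; rewrite /path_ind big1// => l _.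
have lm : (j0 + l < j0 + m)%N by rewrite ltn_add2l.
have /andP[s0 s1] := st _ lm.
by have := DH _ (inD _ s0 s1); rewrite /hs_ind /= => ->.
Qed.

Let t2 : 0 < 4 * t ^+ 2 / (enorm (x - y) ^+ 2 + 1).
Proof. by rewrite divr_gt0 ?mulr_gt0 ?exprn_gt0// ltr_wpDl ?sqr_ge0. Qed.

Let small_time l : l ^+ 2 <= 4 * t ^+ 2 / (enorm (x - y) ^+ 2 + 1) ->
  heat_kernel (t + l ^+ 2) x y <= expR 1 * heat_kernel t x y.
Proof.
move=> lt2; apply: heat_kernel_time_le; rewrite ?sqr_ge0//.
have E1 : 0 < enorm (x - y) ^+ 2 + 1 by rewrite ltr_wpDl ?sqr_ge0.
rewrite ler_pdivlMr// in lt2; apply: le_trans lt2.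
by rewrite ler_wpM2l ?sqr_ge0// lerDl.
Qed.

Lemma dirichlet_le_halfspace e c : dotv e e = 1 -> D `<=` [set z | c < dotv e z] ->
  p y <= cube_cst R n * (8 * expR 1 * expR 1 *
    (heat_kernel t x y * Num.min 1 ((dotv e x - c) * (dotv e y - c) / t))).
Proof.
move=> e1 DH; have cx : c < dotv e x := DH _ Dx; have cy : c < dotv e y := DH _ Dy.
set dx := dotv e x - c; set dy := dotv e y - c.
have dx0 : 0 < dx by rewrite subr_gt0.
have dy0 : 0 < dy by rewrite subr_gt0.
have hk0 := heat_kernel_ge0 t x y.
have m0 : 0 <= Num.min 1 (dx * dy / t).
  by rewrite le_min ler01 divr_ge0 ?(ltW t0)// mulr_ge0// ltW.
have e0 := expR_ge0 (1 : R).
have C0 : 0 <= 8 * expR 1 * expR 1 :> R by rewrite !mulr_ge0.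
apply: (dirichlet_heat_kernel_le bm oD Dy t0 p0 cp PA).
  by apply: mulr_ge0 => //; exact: mulr_ge0.
move=> l0 l00; pose eps := Num.min dx dy.
have eps0 : 0 < eps by rewrite lt_min dx0.
have epsx : eps <= dx by rewrite ge_min lexx.
have epsy : eps <= dy by rewrite ge_min lexx orbT.
have b0 : 0 < Num.min (eps ^+ 2) (4 * t ^+ 2 / (enorm (x - y) ^+ 2 + 1)).
  by rewrite lt_min t2 exprn_gt0.
have [l ll0] := exists_small_square l00 b0; rewrite le_min => /andP[leps lt2].
exists l => //; have l20 : 0 < l ^+ 2 by rewrite exprn_gt0//; case/andP: ll0.
have th0 : 0 < t / 2 by rewrite divr_gt0.
have [M [s [g [hm [ph send st mesh]]]]] := brownian_phases n0 bm x th0 th0 eps0 l20 leps.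
have tE : t / 2 + t / 2 = t by rewrite -splitr.
rewrite !tE in send st mesh.
case: (ph) => walk X0 t1E s0E _ _ _ _ _ h_hm hm_sg _.
exists (path_ind (fun j w => x + W (s j) w) e c 0 (M + M).+1); split.
- apply: (past_measurableT (walk_measurable walk)).
  exact: (past_measurable_path_ind walk _ _ (leqnn _)).
- by move=> w; have /andP[] := path_ind01 (fun j w => x + W (s j) w) e c 0 (M + M).+1 w.
- by move=> w inD; rewrite (path_ind_in DH inD)// => j; rewrite add0n ltnS; exact: st.
have sumE : \sum_(k < M + M) (s k.+1 - s k) = t.
  by rewrite big_split_ord /= -[RHS]tE -{1}t1E -s0E.
have tau_ge : l ^+ 2 + \sum_(k < M + M) (s k.+1 - s k) <= t + l ^+ 2.
  by rewrite sumE addrC.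
have := integral_heat_kernel_start walk X0 (leqnn _) e1 eps0 l20 h_hm hm_sg leps
  tau_ge cx (ltW cy) mesh.
rewrite send => /le_trans; apply; rewrite lee_fin sumE (addrC (l ^+ 2)).
have ts0 : 0 < t + l ^+ 2 by rewrite addr_gt0.
have hk'0 := heat_kernel_ge0 (t + l ^+ 2) x y.
(* The enlargement at most doubles each of the two distances, whence the 4. *)
apply: (@le_trans _ _ (2 * expR 1 * (heat_kernel (t + l ^+ 2) x y *
    (4 * Num.min 1 (dx * dy / t))))); last first.
  rewrite [leLHS](_ : _ = 8 * expR 1 * (heat_kernel (t + l ^+ 2) x y *
    Num.min 1 (dx * dy / t))); last by ring.
  rewrite -[leRHS]mulrA; apply: ler_wpM2l; first exact: mulr_ge0.
  by rewrite mulrA ler_wpM2r// small_time.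
apply: ler_wpM2l; first exact: mulr_ge0.
have [Q1|Q1] := leP 1 (dx * dy / t).
  apply: (le_trans (hs_kernel_le1 _ _ _ _ _)); rewrite mulr1 ler_peMr//; lra.
apply: (le_trans (hs_kernel_le _ _ _ _ ts0)); rewrite ler_wpM2l// mulrA.
have -> : dotv e x - (c - eps) = dx + eps by rewrite /dx; ring.
have -> : dotv e y - (c - eps) = dy + eps by rewrite /dy; ring.
apply: ler_pM.
- by apply: mulr_ge0; rewrite addr_ge0// ltW.
- by rewrite invr_ge0 ltW.
- rewrite (_ : 4 * (dx * dy) = (2 * dx) * (2 * dy)); last by ring.
  by apply: ler_pM; lra.
- by rewrite lef_pV2// lerDl ltW.
Qed.

Lemma dirichlet_le_two_halfspaces e e' c c' :
  dotv e e = 1 -> dotv e' e' = 1 ->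
  D `<=` [set z | c < dotv e z] -> D `<=` [set z | c' < dotv e' z] ->
  dotv e' y - c' <= dotv e y - c -> dotv e x - c <= dotv e' x - c' ->
  (dotv e x - c) * (dotv e y - c) <= t ->
  (dotv e' y - c') * (dotv e' x - c') <= t ->
  p y <= cube_cst R n * (8 * two_phase_cst R * expR 1 * (heat_kernel t x y *
    ((dotv e x - c) * (dotv e' y - c') / t *
      (1 + (dotv e y - c) * (dotv e' x - c') / t)))).
Proof.
move=> e1 e'1 DH DH'.
set dx := dotv e x - c; set dy := dotv e' y - c'.
set al := dotv e y - c; set ga := dotv e' x - c' => dyal dxga dxal dyga.
have dx0 : 0 < dx by rewrite subr_gt0; exact: DH.
have dy0 : 0 < dy by rewrite subr_gt0; exact: DH'.
have al0 : 0 < al by rewrite subr_gt0; exact: DH.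
have ga0 : 0 < ga by rewrite subr_gt0; exact: DH'.
pose r := Num.sqrt t; have r0 : 0 < r by rewrite sqrtr_gt0.
have rt : r ^+ 2 = t by rewrite sqr_sqrtr// ltW.
have [k [k0 dxk dyk alk gak]] := balanced_split r0 rt dx0 dy0 dyal dxga dxal dyga.
have q0 : 0 < 1 + k ^+ 2 by rewrite ltr_pwDl ?sqr_ge0.
pose s0 := t * k ^+ 2 / (1 + k ^+ 2); pose t1 := t / (1 + k ^+ 2).
have t10 : 0 < t1 by rewrite divr_gt0.
have s00 : 0 < s0 by rewrite divr_gt0// mulr_gt0// exprn_gt0.
have stE : s0 + t1 = t by rewrite /s0 /t1; field; rewrite gt_eqF.
(* [v] is the fluctuation scale of the bridge at time [t1]; [u] and [u'] below are the means of the
   two distances at that time. *)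
pose v := r * k / (1 + k ^+ 2).
have v0 : 0 < v by rewrite divr_gt0// mulr_gt0.
have v2 : s0 * t1 / (s0 + t1) = v ^+ 2.
  by rewrite stE /s0 /t1 /v -rt; field; rewrite !gt_eqF.
pose u := (s0 * dx + t1 * al) / (s0 + t1).
pose u' := (t1 * dy + s0 * ga) / (s0 + t1).
have u0 : 0 < u by apply: divr_gt0; [apply: addr_gt0; exact: mulr_gt0|exact: addr_gt0].
have u'0 : 0 < u' by apply: divr_gt0; [apply: addr_gt0; exact: mulr_gt0|exact: addr_gt0].
pose rho := u + v; pose rho' := u' + v.
have rho0 : 0 < rho by rewrite addr_gt0.
have rho'0 : 0 < rho' by rewrite addr_gt0.
have rhoE : dx * rho / t1 = dx / t * (al + dx * k ^+ 2 + r * k).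
  by rewrite /rho /u /v stE /s0 /t1; field; rewrite !gt_eqF.
have rho'E : dy * rho' / s0 = dy / t * (ga + dy / k ^+ 2 + r / k).
  by rewrite /rho' /u' /v stE /s0 /t1; field; rewrite !gt_eqF.
have dxk2 : dx * k ^+ 2 <= r * k by rewrite expr2 mulrA ler_pM2r.
have dyk2 : dy / k ^+ 2 <= r / k.
  rewrite ler_pdivrMr ?exprn_gt0// (_ : r / k * k ^+ 2 = r * k)//.
  by field; rewrite gt_eqF.
(* Each of the three summands in [rhoE] contributes at most 1: the first by [dx * al <= t], the
   other two by [dx * k <= r]. *)
have K3 : dx * rho / t1 <= 3.
  rewrite rhoE mulrAC ler_pdivrMr//; nra.
have prod_le : dx * rho / t1 * (dy * rho' / s0) <=
    8 * (dx * dy / t * (1 + al * ga / t)).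
  rewrite rhoE rho'E.
  apply: (@le_trans _ _ (dx / t * (al + 2 * (r * k)) * (dy / t * (ga + 2 * (r / k))))).
    have rk0 : 0 < r / k by rewrite divr_gt0.
    have rk0' : 0 < r * k by rewrite mulr_gt0.
    have k20 : 0 < k ^+ 2 by rewrite exprn_gt0.
    have dyk0 : 0 < dy / k ^+ 2 by rewrite divr_gt0.
    have dxt : 0 <= dx / t by rewrite divr_ge0 ?ltW.
    have dyt : 0 <= dy / t by rewrite divr_ge0 ?ltW.
    apply: ler_pM.
    - by apply: mulr_ge0 => //; nra.
    - by apply: mulr_ge0 => //; lra.
    - by apply: ler_wpM2l => //; lra.
    - by apply: ler_wpM2l => //; lra.
  (* The balance is used here: the mixed terms [r * al / k] and [r * ga * k] are each at most
     [al * ga + t], for a total of at most [5 * (al * ga) + 8 * t]. *)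
  have -> : dx / t * (al + 2 * (r * k)) * (dy / t * (ga + 2 * (r / k))) =
      dx * dy / t ^+ 2 * (al * ga + 4 * r ^+ 2 + 2 * (r * al / k) + 2 * (r * ga * k)).
    by field; rewrite !gt_eqF.
  have -> : 8 * (dx * dy / t * (1 + al * ga / t)) =
      dx * dy / t ^+ 2 * (8 * (t + al * ga)) by field; rewrite gt_eqF.
  have h1 : r * al / k <= al * ga + t by rewrite ler_pdivrMr// [_ * k]mulrC.
  have alga : 0 < al * ga by rewrite mulr_gt0.
  apply: ler_wpM2l; last by rewrite rt; lra.
  by apply: ltW; apply: divr_gt0; [exact: mulr_gt0|exact: exprn_gt0].
have hk0 := heat_kernel_ge0 t x y.
have e0 := expR_ge0 (1 : R).
have tp0 := ltW (two_phase_cst_gt0 R).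
have Q0 : 0 <= dx * dy / t * (1 + al * ga / t).
  by rewrite mulr_ge0 ?divr_ge0 ?addr_ge0 ?divr_ge0 ?mulr_ge0 ?(ltW dx0) ?(ltW dy0)
    ?(ltW al0) ?(ltW ga0) ?(ltW t0).
have C0 : 0 <= 8 * two_phase_cst R * expR 1 :> R.
  by apply: mulr_ge0 => //; exact: mulr_ge0.
apply: (dirichlet_heat_kernel_le bm oD Dy t0 p0 cp PA).
  by apply: mulr_ge0 => //; exact: mulr_ge0.
move=> l0 l00; pose eps := Num.min (Num.min dx dy) (Num.min rho rho').
have eps0 : 0 < eps by rewrite !lt_min dx0 dy0 rho0.
have [epsx epsy epsr epsr'] : [/\ eps <= dx, eps <= dy, eps <= rho & eps <= rho'].
  by split; rewrite !ge_min lexx ?orbT.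
pose b := Num.min (Num.min (eps ^+ 2) (4 * t ^+ 2 / (enorm (x - y) ^+ 2 + 1)))
  (Num.min s0 t1).
have b0 : 0 < b by rewrite !lt_min t2 exprn_gt0// s00.
have [l ll0] := exists_small_square l00 b0.
rewrite !le_min => /andP[/andP[leps lt2] /andP[ls0 lt1]].
exists l => //; have l20 : 0 < l ^+ 2 by rewrite exprn_gt0//; case/andP: ll0.
have [M [s [g [hm [ph send st mesh]]]]] := brownian_phases n0 bm x t10 s00 eps0 l20 leps.
have stE' : t1 + s0 = t by rewrite addrC.
rewrite stE' in send st.
case: (ph) => walk _ _ _ _ _ _ _ _ _ _ _.
pose X j w := x + W (s j) w.
exists (fun w => path_ind X e c 0 M.+1 w * path_ind X e' c' M M.+1 w); split.
- apply: measurable_funM; apply: (past_measurableT (walk_measurable walk));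
    exact: (past_measurable_path_ind walk _ _ (leqnn _)).
- move=> w; have /andP[? _] := path_ind01 X e c 0 M.+1 w.
  by have /andP[? _] := path_ind01 X e' c' M M.+1 w; rewrite mulr_ge0.
- move=> w inD; rewrite (path_ind_in DH inD); last first.
    by move=> j jM; apply: st; rewrite (leq_trans (jM : (j <= M)%N))// leq_addr.
  by rewrite (path_ind_in DH' inD) ?mulr1// => j; rewrite addnS ltnS; exact: st.
have v2u (a : R) : 0 < a -> s0 * t1 / (s0 + t1) <= (a + v) ^+ 2.
  move=> a0; rewrite v2 lerXn2r ?nnegrE ?addr_ge0 ?(ltW v0) ?(ltW a0)//.
  by rewrite lerDr ltW.
have u_rho : u <= rho by rewrite lerDl ltW.
have u_rho' : u' <= rho' by rewrite lerDl ltW.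
have := two_phase ph e1 e'1 epsx epsy al0 ga0 rho0 rho'0 epsr epsr' ls0 lt1
  u_rho u_rho' (v2u _ u0) (v2u _ u'0) K3.
rewrite -/X /X send => /le_trans; apply; rewrite lee_fin stE.
rewrite -/dx -/dy -mulrA.
apply: (@le_trans _ _ (two_phase_cst R * (8 * (dx * dy / t * (1 + al * ga / t)) *
   (expR 1 * heat_kernel t x y)))).
  rewrite -[leLHS]mulrA ler_wpM2l// mulrA ler_pM ?heat_kernel_ge0//.
  - by apply: ltW; apply: mulr_gt0; apply: divr_gt0 => //; exact: mulr_gt0.
  - exact: small_time.
by rewrite le_eqVlt; apply/orP; left; apply/eqP; ring.
Qed.

End dirichlet_bounds.

Theorem theorem3p4 (R : realType) (n : nat) (r T : R)
  (hn : (0 < n)%N) (hr : 0 < r) (hT : 0 < T) :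
  exists C : R, 0 < C /\
    forall (D : set 'rV[R]_n) (pD : R -> 'rV[R]_n -> 'rV[R]_n -> R),
      domain D -> convex_set D -> C11_class r D ->
      dirichlet_heat_kernel D pD ->
    forall (x y : 'rV[R]_n) (t : R) (Hx Hy : set 'rV[R]_n),
      D x -> D y -> 0 < t -> t < T ->
      halfspace Hx -> halfspace Hy -> D `<=` Hx `&` Hy ->
      dist_boundary Hx x = dist_boundary D x ->
      dist_boundary Hy y = dist_boundary D y ->
      pD t x y <= C * heat_kernel t x y *
        (Num.min 1 (dist_boundary D x * dist_boundary D y / t) +
         Num.min 1 (dist_boundary Hx x * dist_boundary Hx y / t) *
         Num.min 1 (dist_boundary Hy y * dist_boundary Hy x / t)).
Proof.
have e0 := expR_gt0 (1 : R); have k0 := cube_cst_gt0 R n.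
have tp0 := two_phase_cst_gt0 R.
pose C1 : R := 8 * expR 1 * expR 1; pose C2 : R := 8 * two_phase_cst R * expR 1.
have C10 : 0 < C1 by rewrite !mulr_gt0.
have C20 : 0 < C2 by rewrite !mulr_gt0.
exists (cube_cst R n * (C1 + C2)); split; first by rewrite mulr_gt0// addr_gt0.
move=> D pD [oD _ _] _ _ [pD0 [dsp [Om [P [W [bm PW]]]]]] x y t Hx Hy Dx Dy t0 _.
move=> /halfspace_unit[e [c [e1 ->]]] /halfspace_unit[e' [c' [e'1 ->]]] DH hx hy.
have DHx : D `<=` [set z | c < dotv e z] by move=> z /DH[].
have DHy : D `<=` [set z | c' < dotv e' z] by move=> z /DH[].
have xx := DHx _ Dx; have xy := DHx _ Dy; have yx := DHy _ Dx; have yy := DHy _ Dy.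
rewrite -hx -hy !dist_boundary_halfspace//.
have dyal := dist_boundary_le e1 oD Dy DHx.
have dxga := dist_boundary_le e'1 oD Dx DHy.
rewrite -hy dist_boundary_halfspace// in dyal.
rewrite -hx dist_boundary_halfspace// in dxga.
have p0 z : D z -> 0 <= pD t x z by move=> Dz; have [] := pD0 t x z t0 Dx Dz.
have cp : {for y, continuous (pD t x)} by have [] := pD0 t x y t0 Dx Dy.
have PA A := PW t x A t0 Dx.
have bx := dirichlet_le_halfspace hn bm oD Dx Dy t0 p0 cp PA e1 DHx.
have by' := dirichlet_le_halfspace hn bm oD Dx Dy t0 p0 cp PA e'1 DHy.
have bxy := dirichlet_le_two_halfspaces hn bm oD Dx Dy t0 p0 cp PA e1 e'1 DHx DHy
  dyal dxga.
set dx := dotv e x - c in dxga bx bxy *; set dy := dotv e' y - c' in dyal by' bxy *.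
set al := dotv e y - c in dyal bx bxy *; set ga := dotv e' x - c' in dxga by' bxy *.
have dx0 : 0 < dx by rewrite subr_gt0.
have dy0 : 0 < dy by rewrite subr_gt0.
have al0 : 0 < al by rewrite subr_gt0.
have ga0 : 0 < ga by rewrite subr_gt0.
have hk0 := heat_kernel_ge0 t x y.
have m0 a b : 0 < a -> 0 < b -> 0 <= Num.min 1 (a * b / t).
  by move=> a0 b0; rewrite le_min ler01 divr_ge0 ?(ltW t0)// mulr_ge0// ltW.
have m1 := m0 _ _ dx0 dy0; have m2 := m0 _ _ dx0 al0; have m3 := m0 _ _ dy0 ga0.
have finish Ci Q : 0 <= Ci -> Ci <= C1 + C2 -> 0 <= Q ->
    Q <= Num.min 1 (dx * dy / t) + Num.min 1 (dx * al / t) * Num.min 1 (dy * ga / t) ->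
    pD t x y <= cube_cst R n * (Ci * (heat_kernel t x y * Q)) ->
    pD t x y <= cube_cst R n * (C1 + C2) * heat_kernel t x y *
      (Num.min 1 (dx * dy / t) + Num.min 1 (dx * al / t) * Num.min 1 (dy * ga / t)).
  move=> Ci0 CiC Q0 QM /le_trans; apply.
  rewrite -[leRHS]mulrA -[leRHS]mulrA.
  apply: ler_wpM2l; first exact: ltW.
  apply: ler_pM => //.
    exact: mulr_ge0.
  exact: ler_wpM2l.
(* One factor of the product of minima is then 1, and the bound from the other half-space is the
   remaining factor. *)
have [dxal|dxal] := leP t (dx * al).
  apply: (finish C1 _ _ _ _ _ by'); [exact: ltW|by rewrite lerDl ltW|exact: m0|].
  have -> : Num.min 1 (dx * al / t) = 1 by apply/min_idPl; rewrite ler_pdivlMr// mul1r.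
  by rewrite mul1r (mulrC ga) lerDr.
have [dyga|dyga] := leP t (dy * ga).
  apply: (finish C1 _ _ _ _ _ bx); [exact: ltW|by rewrite lerDl ltW|exact: m0|].
  have -> : Num.min 1 (dy * ga / t) = 1 by apply/min_idPl; rewrite ler_pdivlMr// mul1r.
  by rewrite mulr1 lerDr.
have minE a : a <= t -> Num.min 1 (a / t) = a / t.
  by move=> a_t; apply/min_idPr; rewrite ler_pdivrMr// mul1r.
apply: (finish C2 _ _ _ _ _ (bxy (ltW dxal) (ltW dyga))).
- exact: ltW.
- by rewrite lerDr ltW.
- apply: ltW; apply: mulr_gt0; first by apply: divr_gt0 => //; exact: mulr_gt0.
  by apply: addr_gt0 => //; apply: divr_gt0 => //; exact: mulr_gt0.
(* As [dy <= al], also [dx * dy <= t]: none of the three minima is cut off at 1, and the claim is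
   the expanded product. *)
rewrite !minE ?(ltW dxal) ?(ltW dyga)//; last first.
  by apply: le_trans (ltW dxal); rewrite ler_pM2l.
rewrite le_eqVlt; apply/orP; left; apply/eqP; field; rewrite gt_eqF//.
Qed.
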